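(* Let $L$ be a language consisting of relation symbols and unary function symbols equipped with a permutation group $\Gamma_L$ and let $\mathcal E$ be a class of finite $\Gamma_L$-structures which has EPPA. Let $\mathcal K$ be a hereditary locally finite automorphism-preserving subclass of $\mathcal E$ with the strong amalgamation property which consists of irreducible structures. Then $\mathcal K$ has EPPA. Moreover, if EPPA-witnesses in $\mathcal E$ can be chosen to be coherent, then EPPA-witnesses in $\mathcal K$ can be chosen to be coherent, too.
   Context: Structures. A language $L$ consists of relation symbols $R$ (of arity $a(R)\ge 1$) and function symbols $F$ (of arity $a(F)\ge 0$; $F$ is unary if $a(F)=1$). $L$ is equipped with a permutation group $\Gamma_L$ if $\Gamma_L$ is a group of permutations of $L$ mapping relation symbols to relation symbols and function symbols to function symbols and preserving arities. A $\Gamma_L$-structure $\mathbf A$ has a finite or countably infinite vertex set $A$, a relation $R_{\mathbf A}\subseteq A^{a(R)}$ for each relation symbol $R\in L$, and a function $F_{\mathbf A}\colon A^{a(F)}\to\mathcal P(A)$ (the power set of $A$) for each function symbol $F\in L$. It is finite if $A$ is finite. Maps. A homomorphism $f\colon\mathbf A\to\mathbf B$ is a pair $f=(f_L,f_A)$ with $f_L\in\Gamma_L$ and $f_A\colon A\to B$ such that, for all $R,F\in L$ and all tuples $\bar x$, $\bar x\in R_{\mathbf A}$ implies $f_A(\bar x)\in f_L(R)_{\mathbf B}$, and $f_A(F_{\mathbf A}(\bar x))\subseteq f_L(F)_{\mathbf B}(f_A(\bar x))$. It is an embedding if $f_A$ is injective, the implication is an equivalence and the inclusion is an equality. An isomorphism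 is an embedding with $f_A$ bijective; an automorphism is an isomorphism of a structure to itself; $\mathrm{Aut}(\mathbf A)$ is the group of automorphisms. Maps compose componentwise (language parts and vertex parts). $\mathbf A$ is a substructure of $\mathbf B$ if $A\subseteq B$ and the pair ($\mathrm{id}_L$, inclusion) is an embedding. For an embedding $f\colon\mathbf A\to\mathbf B$, $f(\mathbf A)$ is the substructure of $\mathbf B$ with vertex set $f_A(A)$. Amalgamation and irreducibility. Given embeddings $\alpha_i\colon\mathbf A\to\mathbf B_i$ ($i=1,2$), an amalgamation of $\mathbf B_1,\mathbf B_2$ over $\mathbf A$ with respect to $\alpha_1,\alpha_2$ is a structure $\mathbf C$ with embeddings $\beta_i\colon\mathbf B_i\to\mathbf C$ such that $\beta_1\alpha_1=\beta_2\alpha_2$ (including language parts). It is strong if $\beta_1(B_1)\cap\beta_2(B_2)=\beta_1\alpha_1(A)$. A strong amalgamation is free if $C=\beta_1(B_1)\cup\beta_2(B_2)$ and whenever a tuple $\bar x$ of vertices of $\mathbf C$ contains vertices of both $\beta_1(B_1\setminus\alpha_1(A))$ and $\beta_2(B_2\setminus\alpha_2(A))$, then $\bar x$ is in no relation of $\mathbf C$ and $F_{\mathbf C}(\bar x)=\emptyset$ for every $F\in L$ of the corresponding arity. A structure is irreducible if it is not a free amalgamation of two of its proper substructures (over a common substructure, with respect to inclusions). A homomorphism $f\colon\mathbf A\to\mathbf B$ is a homomorphism-embedding if its restriction to every irreducible substructure of $\mathbf A$ is an embedding. A class $\mathcal K$ is hereditary if $\mathbf B\in\mathcal K$ and $\mathbf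 A$ embedding into $\mathbf B$ imply $\mathbf A\in\mathcal K$. It has the strong amalgamation property if for all $\mathbf A,\mathbf B_1,\mathbf B_2\in\mathcal K$ and embeddings $\alpha_i\colon\mathbf A\to\mathbf B_i$ there is $\mathbf C\in\mathcal K$ which is a strong amalgamation of $\mathbf B_1,\mathbf B_2$ over $\mathbf A$ with respect to $\alpha_1,\alpha_2$. Completions. An irreducible structure $\mathbf C'$ is a completion of a structure $\mathbf C$ if there is a homomorphism-embedding $\mathbf C\to\mathbf C'$. It is a strong completion if the homomorphism-embedding is injective. A completion is automorphism-preserving if it is strong and (identifying $\mathbf C$ with its image under the injective homomorphism-embedding $f\colon\mathbf C\to\mathbf C'$) for every $\alpha\in\mathrm{Aut}(\mathbf C)$ there is $\alpha'\in\mathrm{Aut}(\mathbf C')$ extending $\alpha$, i.e. $\alpha'f=f\alpha$, and moreover the map $\alpha\mapsto\alpha'$ is a group homomorphism $\mathrm{Aut}(\mathbf C)\to\mathrm{Aut}(\mathbf C')$. Local finiteness. Let $\mathcal E$ be a class of finite $\Gamma_L$-structures and $\mathcal K\subseteq\mathcal E$ a subclass consisting of irreducible structures. $\mathcal K$ is a locally finite subclass of $\mathcal E$ if for every $\mathbf A\in\mathcal K$ and every $\mathbf B_0\in\mathcal E$ there is a finite integer $n=n(\mathbf A,\mathbf B_0)$ such that every finite $\Gamma_L$-structure $\mathbf B$ has a completion $\mathbf B'\in\mathcal K$, provided that: (1) every irreducible substructure of $\mathbf B$ has an embedding to $\mathbf A$; (2) there is a homomorphism-embedding from $\mathbf B$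 to $\mathbf B_0$; and (3) every substructure of $\mathbf B$ on at most $n$ vertices has a completion in $\mathcal K$. It is a locally finite automorphism-preserving subclass if $\mathbf B'$ can always be chosen to be an automorphism-preserving completion. EPPA. A partial automorphism of $\mathbf A$ is an isomorphism $f$ between substructures of $\mathbf A$; its language part $f_L\in\Gamma_L$ is part of the data, and $\mathrm{dom}(f)$, $\mathrm{range}(f)$ refer to its vertex part. An automorphism $\theta$ extends $f$ if $\theta$ has the same language part as $f$ and its vertex part extends that of $f$. A finite $\mathbf B$ is an EPPA-witness for a finite $\mathbf A$ if there is an embedding $\psi\colon\mathbf A\to\mathbf B$ such that every partial automorphism of $\psi(\mathbf A)$ extends to an automorphism of $\mathbf B$. It is coherent if moreover (for this $\psi$) one can choose, for each partial automorphism $f$ of $\psi(\mathbf A)$, an automorphism $\hat f$ of $\mathbf B$ extending $f$ so that $\widehat{gf}=\hat g\hat f$ whenever $\mathrm{range}(f)=\mathrm{dom}(g)$. A class $\mathcal K$ of finite $\Gamma_L$-structures has EPPA if every $\mathbf A\in\mathcal K$ has an EPPA-witness $\mathbf B\in\mathcal K$; EPPA-witnesses in $\mathcal K$ can be chosen to be coherent if every $\mathbf A\in\mathcal K$ has a coherent EPPA-witness in $\mathcal K$. *)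

(* Defs.v *)
From mathcomp Require Import all_boot.
From mathcomp Require Import boolp classical_sets functions cardinality.

Set Implicit Arguments.
Unset Strict Implicit.
Unset Printing Implicit Defensive.

Local Open Scope classical_set_scope.
Local Open Scope card_scope.

(* A language is given by its symbols of each arity; function symbols may be
   nullary, relation symbols may not. *)
Record language := Language {
  rels : nat -> Type;
  funs : nat -> Type;
  rels_gt0 : rels 0 -> False }.

Definition unary_functions (L : language) := forall n, funs L n -> n = 1.

(* Arity-preserving permutations of a family of symbols.  The inverse is a
   field, so that Leibniz equality is equality of the maps (by function
   extensionality and proof irrelevance). *)
Record gperm (S : nat -> Type) := GPerm {
  gfun : forall n, S n -> S n;
  ginv : forall n, S n -> S n;
  gfunK : forall n, cancel (@gfun n) (@ginv n);
  ginvK : forall n, cancel (@ginv n) (@gfun n) }.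

Definition gid S : gperm S :=
  @GPerm S (fun n => id) (fun n => id) (fun n x => erefl) (fun n x => erefl).

Definition gcomp S (h g : gperm S) : gperm S :=
  @GPerm S (fun n => @gfun S h n \o @gfun S g n)
    (fun n => @ginv S g n \o @ginv S h n)
    (fun n => can_comp (@gfunK S h n) (@gfunK S g n))
    (fun n => can_comp (@ginvK S g n) (@ginvK S h n)).

Definition gsym S (g : gperm S) : gperm S :=
  GPerm (@ginvK S g) (@gfunK S g).

Record lperm (L : language) := LPerm {
  rperm : gperm (rels L);
  fperm : gperm (funs L) }.

Definition lrel L (g : lperm L) n (R : rels L n) : rels L n := gfun (rperm g) R.
Definition lfun L (g : lperm L) n (F : funs L n) : funs L n := gfun (fperm g) F.

Definition lid L : lperm L := LPerm (gid _) (gid _).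
Definition lcomp L (h g : lperm L) : lperm L :=
  LPerm (gcomp (rperm h) (rperm g)) (gcomp (fperm h) (fperm g)).
Definition linv L (g : lperm L) : lperm L :=
  LPerm (gsym (rperm g)) (gsym (fperm g)).

Record permgroup (L : language) := PermGroup {
  pgset : set (lperm L);
  pg1 : pgset (lid L);
  pgM : forall h g, pgset h -> pgset g -> pgset (lcomp h g);
  pgV : forall g, pgset g -> pgset (linv g) }.

(* The vertex set may be empty. *)
Record structure (L : language) := Structure {
  vert :> Type;
  vert_countable : countable [set: vert];
  rint : forall n, rels L n -> set (n.-tuple vert);
  fint : forall n, funs L n -> n.-tuple vert -> set vert }.

Definition finite_structure L (A : structure L) := finite_set [set: A].

(* Not [set (structure L)], which is ruled out by universe constraints. *)
Definition class L := structure L -> Prop.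

Definition subclass L (K E : class L) := forall A, K A -> E A.

Section Maps.
Variables (L : language) (G : permgroup L).
Implicit Types A B C : structure L.

(* A pair of a permutation in G and a vertex map, without further conditions. *)
Record smap A B := SMap {
  mlang : lperm L;
  mlangP : pgset G mlang;
  mvert :> A -> B }.

Definition mcomp A B C (g : smap B C) (f : smap A B) : smap A C :=
  SMap (pgM (mlangP g) (mlangP f)) (mvert g \o mvert f).

Definition homomorphism A B (f : smap A B) :=
  (forall n (R : rels L n) (x : n.-tuple A),
     rint R x -> rint (lrel (mlang f) R) (map_tuple f x)) /\
  (forall n (F : funs L n) (x : n.-tuple A),
     f @` fint F x `<=` fint (lfun (mlang f) F) (map_tuple f x)).

Definition embedding A B (f : smap A B) :=
  [/\ injective f,
      forall n (R : rels L n) (x : n.-tuple A),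
        rint R x <-> rint (lrel (mlang f) R) (map_tuple f x) &
      forall n (F : funs L n) (x : n.-tuple A),
        f @` fint F x = fint (lfun (mlang f) F) (map_tuple f x)].

Definition isomorphism A B (f : smap A B) := embedding f /\ bijective f.

Definition automorphism A (f : smap A A) := isomorphism f.

Lemma induced_countable A (S : set A) : countable [set: S].
Proof.
have /countable_injP[f finj] := vert_countable A.
apply/countable_injP; exists (f \o val) => u v _ _ /= fuv.
by apply/val_inj/finj; rewrite ?inE.
Qed.

(* The structure induced on an arbitrary set of vertices S; it is a
   substructure only when S satisfies [substructure] below. *)
Definition induced A (S : set A) : structure L :=
  @Structure L S (induced_countable S)
    (fun n R x => rint R (map_tuple val x))
    (fun n F x => val @^-1` fint F (map_tuple val x)).

Definition inclusion A (S : set A) : smap (induced S) A :=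
  SMap (pg1 G) (fun v : induced S => val v).

Definition inclusion_sub A (S T : set A) (ST : S `<=` T) :
    smap (induced S) (induced T) :=
  @SMap (induced S) (induced T) _ (pg1 G)
    (fun v : S => SigSub (mem_set (ST _ (set_valP v))) : T).

Definition substructure A (S : set A) := embedding (inclusion S).

Section Amalgamation.
Variables (A B1 B2 C : structure L).
Variables (a1 : smap A B1) (a2 : smap A B2) (b1 : smap B1 C) (b2 : smap B2 C).

Definition amalgamation :=
  [/\ embedding b1, embedding b2 & mcomp b1 a1 = mcomp b2 a2].

Definition strong_amalgamation :=
  amalgamation /\ range b1 `&` range b2 = range (mcomp b1 a1).

Definition meets n (x : n.-tuple C) (S : set C) := exists i, S (tnth x i).

Definition free_amalgamation :=
  [/\ strong_amalgamation,
      range b1 `|` range b2 = [set: C] &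
      forall n (x : n.-tuple C),
        meets x (b1 @` (~` range a1)) -> meets x (b2 @` (~` range a2)) ->
        (forall R : rels L n, ~ rint R x) /\
        (forall F : funs L n, fint F x = set0)].

End Amalgamation.

Definition irreducible A :=
  ~ exists (S0 S1 S2 : set A) (S01 : S0 `<=` S1) (S02 : S0 `<=` S2),
      [/\ [/\ substructure S0, substructure S1 & substructure S2],
          S1 <> [set: A], S2 <> [set: A] &
          free_amalgamation (inclusion_sub S01) (inclusion_sub S02)
            (inclusion S1) (inclusion S2)].

Definition homomorphism_embedding A B (f : smap A B) :=
  homomorphism f /\
  forall S : set A, substructure S -> irreducible (induced S) ->
    embedding (mcomp f (inclusion S)).

Definition completion C C' :=
  irreducible C' /\ exists f : smap C C', homomorphism_embedding f.

Definition automorphism_preserving_completion C C' :=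
  irreducible C' /\
  exists f : smap C C',
    [/\ homomorphism_embedding f, injective f &
        exists ext : smap C C -> smap C' C',
          (forall u, automorphism u ->
             automorphism (ext u) /\ mcomp (ext u) f = mcomp f u) /\
          (forall u v, automorphism u -> automorphism v ->
             ext (mcomp u v) = mcomp (ext u) (ext v))].

Definition hereditary (K : class L) :=
  forall A B, K B -> (exists f : smap A B, embedding f) -> K A.

Definition strong_amalgamation_property (K : class L) :=
  forall A B1 B2 (a1 : smap A B1) (a2 : smap A B2),
    K A -> K B1 -> K B2 -> embedding a1 -> embedding a2 ->
    exists C (b1 : smap B1 C) (b2 : smap B2 C),
      K C /\ strong_amalgamation a1 a2 b1 b2.

Definition locally_finite_automorphism_preserving (K E : class L) :=
  [/\ subclass E (@finite_structure L), subclass K E,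
      subclass K irreducible &
      forall A B0, K A -> E B0 -> exists n : nat,
        forall B, finite_structure B ->
          (forall S : set B, substructure S -> irreducible (induced S) ->
             exists f : smap (induced S) A, embedding f) ->
          (exists f : smap B B0, homomorphism_embedding f) ->
          (forall S : set B, substructure S -> S #<= `I_n ->
             exists C, K C /\ completion (induced S) C) ->
          exists B', K B' /\ automorphism_preserving_completion B B'].

(* Partial automorphisms from S to T; the condition range(f) = dom(g) for
   composing them is thus expressed by typing. *)
Definition partial_automorphism A (S T : set A)
    (f : smap (induced S) (induced T)) :=
  [/\ substructure S, substructure T & isomorphism f].

Definition extends A B (psi : smap A B) (S T : set (induced (range psi)))
    (f : smap (induced S) (induced T)) (t : smap B B) :=
  mlang t = mlang f /\
  forall v : induced S, t (val (val v)) = val (val (f v)).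

Definition EPPA_witness A B :=
  [/\ finite_structure A, finite_structure B &
      exists psi : smap A B, embedding psi /\
        forall (S T : set (induced (range psi)))
               (f : smap (induced S) (induced T)),
          partial_automorphism f ->
          exists t : smap B B, automorphism t /\ extends f t].

Definition coherent_EPPA_witness A B :=
  [/\ finite_structure A, finite_structure B &
      exists psi : smap A B, embedding psi /\
        exists ext : forall S T : set (induced (range psi)),
            smap (induced S) (induced T) -> smap B B,
          (forall S T (f : smap (induced S) (induced T)),
             partial_automorphism f ->
             automorphism (ext S T f) /\ extends f (ext S T f)) /\
          (forall S T U (f : smap (induced S) (induced T))
                        (g : smap (induced T) (induced U)),
             partial_automorphism f -> partial_automorphism g ->
             ext S U (mcomp g f) = mcomp (ext T U g) (ext S T f))].

Definition has_EPPA (K : class L) :=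
  forall A, K A -> exists B, K B /\ EPPA_witness A B.

Definition has_coherent_EPPA (K : class L) :=
  forall A, K A -> exists B, K B /\ coherent_EPPA_witness A B.

End Maps.

(* Main.v *)
From HB Require Import structures.
From mathcomp Require Import all_boot.
From mathcomp Require Import boolp classical_sets functions cardinality.
Require Import Defs.

Set Implicit Arguments.
Unset Strict Implicit.
Unset Printing Implicit Defensive.

(** The theorem is proved by building, from an EPPA-witness B0 in E of a
structure A in K, a finite structure X that is again an EPPA-witness of A, that
maps to B0, whose irreducible substructures embed in A, and whose small
substructures have completions in K.  Local finiteness then gives an
automorphism-preserving completion B' of X in K.  As A is irreducible, the copy
of A in X is still a copy in B', and a partial automorphism of it extends to X
and from there to B', multiplicatively whenever the extension to X is.

The structure X is covered by copies of A, the edges of the record [system]; at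
the start they are the images of A under the automorphisms of B0.  Call two
vertices adjacent when they share an edge, and a system conformal when every
substructure whose vertices are pairwise adjacent lies in an edge.

A single construction improves a system ([covering_exists]).  A twist is a set W
of vertices with a relation t on it which, on each edge, is the kernel of some
map to q + 1 values.  A section over an edge chooses such a map for every twist
at once, and a vertex of the covering is a vertex x with the restriction of a
section to the closure of x under the functions; closures are needed for the
functions to lift to functions.  Two sections over the same set differ, twist by
twist, by a permutation of the q + 1 values, so automorphisms lift, and the lift
can be corrected by permutations so that it extends a given partial
automorphism.  The corrections are completions of partial injections; taking the
order-preserving bijection between the complements makes them, hence the
lifts, compose ([complete_comp]).

Cliques and adjacencies of a system need not lift to its covering. If q + 2
pairwise adjacent vertices of a substructure lie in no edge, take W to be this
set and t the equality: an edge meets W in at most q + 1 points, so this is a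
twist, but pairwise adjacent lifts of all of W would need q + 2 distinct values.
Hence finitely many coverings give a conformal system ([conformal_exists]).

Now let M be a substructure of a conformal system, with vertices a and b that
are not adjacent. Let C be the component of b among the vertices of M not
adjacent to a, and T the set of the vertices of M outside C adjacent to C; all
of T is adjacent to a. If T is a clique, it lies in an edge, so that completions
of C and T together and of M without C both embed T and can be amalgamated over
it. If T has nonadjacent vertices u and v, then the relation on a, u, v and C
that separates just a from u is a twist for two values: no edge contains both u
and v, or both a and a vertex of C. But going from a to v, through C and to u
shows that no map has this kernel along all adjacent pairs of M. By induction,
if all twists for two values are kernels along the adjacent pairs of M, then M
has a completion in K, even one that embeds the part of M in each edge
([flat_completable]).

Thus, in the covering for two values of a conformal system, a substructure
without such a completion misses at least one adjacency of its image, which has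
no completion either: the number of its nonadjacent pairs exceeds that of its
image ([nonadjacent_covering]). After n ^ 2 + 1 coverings, every substructure
without a completion has more than n vertices. *)

(** * Language permutations and maps that embed a set of vertices *)

(** The inverse is determined by the map, and the remaining fields are proofs. *)
Lemma gperm_eq S (g h : gperm S) :
  (forall n, @gfun S g n =1 @gfun S h n) -> g = h.
Proof.
case: g h => [f f' fK f'K] [h h' hK h'K] /= fh.
have eq_f : f = h.
  by apply: functional_extensionality_dep => n; apply/funext/fh.
subst h; have eq_f' : f' = h'.
  apply: functional_extensionality_dep => n; apply/funext => x.
  by rewrite -{1}(h'K n x) fK.
by subst h'; congr GPerm; exact: Prop_irrelevance.
Qed.

Lemma lperm_eq L (g h : lperm L) :
  (forall n (R : rels L n), lrel g R = lrel h R) ->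
  (forall n (F : funs L n), lfun g F = lfun h F) -> g = h.
Proof.
case: g h => [r f] [r' f'] /= rr' ff'.
by congr LPerm; apply: gperm_eq.
Qed.

Lemma lcomp1 L (g : lperm L) : lcomp (lid L) g = g.
Proof. exact: lperm_eq. Qed.

Lemma lcompg1 L (g : lperm L) : lcomp g (lid L) = g.
Proof. exact: lperm_eq. Qed.

Lemma lcompA L (f g h : lperm L) : lcomp f (lcomp g h) = lcomp (lcomp f g) h.
Proof. exact: lperm_eq. Qed.

Lemma lcompgV L (g : lperm L) : lcomp g (linv g) = lid L.
Proof. by apply: lperm_eq => n x; rewrite /lrel /lfun /= ginvK. Qed.

Lemma lrelKV L (g : lperm L) n (R : rels L n) : lrel g (lrel (linv g) R) = R.
Proof. by rewrite /lrel /= ginvK. Qed.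

Lemma lfunKV L (g : lperm L) n (F : funs L n) : lfun g (lfun (linv g) F) = F.
Proof. by rewrite /lfun /= ginvK. Qed.

Lemma map_tuple_comp (A B C : Type) n (g : B -> C) (f : A -> B) (t : n.-tuple A) :
  map_tuple g (map_tuple f t) = map_tuple (g \o f) t.
Proof. by apply: val_inj; rewrite /= map_comp. Qed.

Lemma eq_in_map_tuple (A B : Type) n (f g : A -> B) (t : n.-tuple A) :
  (forall i, f (tnth t i) = g (tnth t i)) -> map_tuple f t = map_tuple g t.
Proof. by move=> fg; apply: eq_from_tnth => i; rewrite !tnth_map. Qed.

Lemma map_tuple1 (T U : Type) (f : T -> U) a : map_tuple f [tuple a] = [tuple f a].
Proof. exact: val_inj. Qed.

Section PartialEmbeddings.
Variables (L : language) (G : permgroup L).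
Implicit Types A B C : structure L.

Lemma smap_eq A B (f g : smap G A B) : mlang f = mlang g -> f =1 g -> f = g.
Proof.
case: f g => [l lG f] [l' lG' f'] /= eq_l /funext eq_f.
by subst l' f'; rewrite (Prop_irrelevance lG lG').
Qed.

Definition within A n (t : n.-tuple A) (S : set A) := forall i, S (tnth t i).

(** For a substructure S, this says that the restriction of f to S is an embedding
([embedding_inclusion]); f itself stays a total map, so that maps defined on
different substructures compose and compare without coercions. *)
Definition embeds_on A B (f : smap G A B) (S : set A) :=
  [/\ forall x y, S x -> S y -> f x = f y -> x = y,
      forall n (R : rels L n) (t : n.-tuple A), within t S ->
        (rint R t <-> rint (lrel (mlang f) R) (map_tuple f t)) &
      forall n (F : funs L n) (t : n.-tuple A), within t S ->
        (f @` fint F t = fint (lfun (mlang f) F) (map_tuple f t))%classic].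

Lemma embedding_setT A B (f : smap G A B) :
  embedding f <-> embeds_on f [set: A]%classic.
Proof.
split=> [[finj fR fF]|[finj fR fF]]; split=> //.
- by move=> x y _ _; apply: finj.
- by move=> x y; apply: finj.
- by move=> n R t; apply: fR.
- by move=> n F t; apply: fF.
Qed.

Lemma embeds_on_sub A B (S T : set A) (f : smap G A B) :
  (S `<=` T)%classic -> embeds_on f T -> embeds_on f S.
Proof.
move=> ST [finj fR fF]; split=> [x y /ST Tx /ST Ty|n R t tS|n F t tS].
- exact: finj.
- by apply: fR => i; apply/ST/tS.
- by apply: fF => i; apply/ST/tS.
Qed.

Lemma embeds_on_comp A B C (S : set A) (T : set B)
    (g : smap G B C) (f : smap G A B) :
  (forall x, S x -> T (f x)) -> embeds_on f S -> embeds_on g T ->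
  embeds_on (mcomp g f) S.
Proof.
move=> ST [finj fR fF] [ginj gR gF].
have fT n (t : n.-tuple A) : within t S -> within (map_tuple f t) T.
  by move=> tS i; rewrite tnth_map; apply/ST/tS.
split=> [x y Sx Sy /= /ginj/finj|n R t tS|n F t tS].
- by apply=> //; apply: ST.
- by rewrite (fR _ _ _ tS) (gR _ _ _ (fT _ _ tS)) map_tuple_comp.
- by rewrite -image_comp (fF _ _ _ tS) (gF _ _ _ (fT _ _ tS)) map_tuple_comp.
Qed.

Lemma embedding_comp A B C (g : smap G B C) (f : smap G A B) :
  embedding f -> embedding g -> embedding (mcomp g f).
Proof.
move=> /embedding_setT ef /embedding_setT eg.
exact/embedding_setT/(embeds_on_comp _ ef eg).
Qed.

Lemma embedding_homomorphism A B (f : smap G A B) :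
  embedding f -> homomorphism f.
Proof.
case=> _ fR fF; split=> [n R t|n F t]; first by rewrite -fR.
by rewrite fF.
Qed.

Lemma embeds_on_eq A B (S : set A) (f g : smap G A B) :
  mlang f = mlang g -> (forall x, S x -> f x = g x) ->
  (forall n (F : funs L n) (t : n.-tuple A), within t S ->
     (fint F t `<=` S)%classic) ->
  embeds_on f S -> embeds_on g S.
Proof.
move=> fg_l fg S_closed [finj fR fF].
have map_fg n (t : n.-tuple A) : within t S -> map_tuple f t = map_tuple g t.
  by move=> tS; apply: eq_in_map_tuple => i; apply/fg/tS.
split=> [x y Sx Sy|n R t tS|n F t tS].
- by rewrite -!fg //; apply: finj.
- by rewrite -fg_l -map_fg //; apply: fR.
- rewrite -fg_l -map_fg // -fF //; apply/seteqP; split=> _ [x Fx <-].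
  + by exists x => //; apply: fg; apply: S_closed Fx.
  + by exists x => //; rewrite fg //; apply: S_closed Fx.
Qed.

Lemma substructureP A (S : set A) :
  substructure G S <-> forall n (F : funs L n) (t : n.-tuple A),
    within t S -> (fint F t `<=` S)%classic.
Proof.
split=> [[_ _ sF] n F t tS y Fty|S_closed].
- pose u : n.-tuple (induced S) :=
    [tuple (SigSub (mem_set (tS i)) : induced S) | i < n].
  have tu : t = map_tuple (inclusion G S) u.
    by apply: eq_from_tnth => i; rewrite tnth_map tnth_mktuple.
  move: Fty; rewrite tu -[F in fint F]/(lfun (mlang (inclusion G S)) F) -sF.
  by move=> [v _ <-]; apply: set_valP.
- split=> [|//|n F t]; first exact: val_inj.
  apply/seteqP; split=> [_ [v Fv <-] //|y Fy].
  have Sy : S y.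
    by apply: S_closed Fy => i; rewrite tnth_map; apply: set_valP.
  by exists (SigSub (mem_set Sy)).
Qed.

Lemma embedding_inclusion A B (S : set A) (f : smap G A B) :
  substructure G S -> embedding (mcomp f (inclusion G S)) <-> embeds_on f S.
Proof.
move=> subS; split=> [[finj fR fF]|fS]; last first.
  apply/embedding_setT; apply: (embeds_on_comp (T := S)) fS.
    by move=> v _; apply: set_valP.
  exact/embedding_setT.
have lift n (t : n.-tuple A) : within t S ->
    exists u : n.-tuple (induced S), t = map_tuple val u.
  move=> tS.
  exists [tuple (SigSub (mem_set (tS i)) : induced S) | i < n].
  by apply: eq_from_tnth => i; rewrite tnth_map tnth_mktuple.
split=> [x y Sx Sy fxy|n R t /lift[u ->]|n F t tS].
- pose x' : induced S := SigSub (mem_set Sx).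
  pose y' : induced S := SigSub (mem_set Sy).
  by rewrite -[x]/(val x') -[y]/(val y') (finj x' y').
- by have := fR n R u; rewrite map_tuple_comp; apply.
- have /substructureP S_closed := subS.
  have FS := S_closed n F t tS.
  have [u tu] := lift n t tS; subst t.
  rewrite map_tuple_comp; rewrite -[RHS](fF n F u).
  apply/seteqP; split=> _ [y Fy <-]; last by exists (val y).
  by exists (SigSub (mem_set (FS y Fy))).
Qed.

(** Restricting the codomain of a map changes its type, so it is recognised as an
embedding by composing it with an inclusion. *)
Lemma embedding_mcompr A B C (g : smap G B C) (f : smap G A B) :
  embedding g -> embedding (mcomp g f) -> embedding f.
Proof.
move=> [ginj gR gF] [finj fR fF]; split=> [x y fxy|n R t|n F t].
- by apply: finj; rewrite /= fxy.
- by rewrite fR gR map_tuple_comp.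
- have img_sub (S T : set B) : (g @` S = g @` T -> S `<=` T)%classic.
    move=> ST y Sy; have : (g @` T)%classic (g y) by rewrite -ST; exists y.
    by move=> [z Tz /ginj <-].
  have img_inj (S T : set B) : (g @` S = g @` T -> S = T)%classic.
    by move=> ST; apply/seteqP; split; apply: img_sub.
  apply: img_inj; rewrite gF map_tuple_comp image_comp.
  exact: fF.
Qed.

Lemma embeds_on_inverse A B (f : smap G A B) (g : B -> A) :
  embedding f -> cancel f g -> embeds_on (SMap (pgV (mlangP f)) g) (range f).
Proof.
move=> [finj fR fF] fK.
have lift n (t : n.-tuple B) : within t (range f) ->
    t = map_tuple f (map_tuple g t).
  move=> tS; apply: eq_from_tnth => i; rewrite !tnth_map.
  by have [a _ <-] := tS i; rewrite fK.
split=> [_ _ [a _ <-] [b _ <-]|n R t /lift tE|n F t /lift tE] /=.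
- by rewrite !fK => ->.
- by rewrite fR lrelKV -tE.
- rewrite {1}tE -{1}(lfunKV (mlang f) F) -fF image_comp.
  rewrite -[RHS]image_id; apply: eq_imagel => x _ /=.
  exact: fK.
Qed.

End PartialEmbeddings.

(** * Coherent completion of partial injections *)

Section PartialInjections.
Variable T : finType.
Implicit Types r s : rel T.

Definition partial_injection r :=
  forall u v u' v', r u v -> r u' v' -> (u == u') = (v == v').

Definition rdom r := [pred u | [exists v, r u v]].
Definition rimg r := [pred v | [exists u, r u v]].

(** Outside its domain the partial injection is completed by the
order-preserving bijection between the complements of domain and image.  The
default value of [nth] is never reached ([complete_out_lt]). *)
Definition complete r u : T :=
  if [pick v | r u v] is Some v then v
  else nth u (enum (predC (rimg r))) (index u (enum (predC (rdom r)))).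

Lemma complete_in r u v : partial_injection r -> r u v -> complete r u = v.
Proof.
move=> r_inj ruv; rewrite /complete; case: pickP => [w ruw|/(_ v)]; last first.
  by rewrite ruv.
by apply/eqP; rewrite -(r_inj _ _ _ _ ruw ruv).
Qed.

Lemma complete_out r u : u \notin rdom r ->
  complete r u = nth u (enum (predC (rimg r))) (index u (enum (predC (rdom r)))).
Proof.
by move=> ur; rewrite /complete; case: pickP => // v ruv; case/existsP: ur; exists v.
Qed.

Lemma card_rdom r : partial_injection r -> #|rdom r| = #|rimg r|.
Proof.
move=> r_inj; rewrite -(card_in_imset (f := complete r) (D := rdom r)).
  apply: eq_card => v; rewrite inE; apply/imsetP/existsP.
    by move=> [u /existsP[w ruw] ->]; exists u; rewrite (complete_in r_inj ruw).
  by move=> [u ruv]; exists u; rewrite ?(complete_in r_inj ruv) //; apply/existsP; exists v.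
move=> u u' /existsP[v ruv] /existsP[v' ruv'].
rewrite (complete_in r_inj ruv) (complete_in r_inj ruv') => /eqP.
by rewrite -(r_inj _ _ _ _ ruv ruv') => /eqP.
Qed.

Lemma size_compl r : partial_injection r ->
  size (enum (predC (rdom r))) = size (enum (predC (rimg r))).
Proof.
move=> r_inj; rewrite -!cardE; apply: (@addnI #|rdom r|).
by rewrite cardC [in RHS](card_rdom r_inj) cardC.
Qed.

Lemma complete_out_lt r u : partial_injection r -> u \notin rdom r ->
  index u (enum (predC (rdom r))) < size (enum (predC (rimg r))).
Proof. by move=> r_inj ur; rewrite -size_compl // index_mem mem_enum. Qed.

Lemma complete_outN r u : partial_injection r -> u \notin rdom r ->
  complete r u \notin rimg r.
Proof.
move=> r_inj ur; rewrite complete_out //.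
have := mem_nth u (complete_out_lt r_inj ur).
by rewrite mem_enum.
Qed.

Lemma complete_inN r u : partial_injection r -> u \in rdom r ->
  complete r u \in rimg r.
Proof.
move=> r_inj /existsP[v ruv]; rewrite (complete_in r_inj ruv).
by apply/existsP; exists u.
Qed.

Lemma complete_inj r : partial_injection r -> injective (complete r).
Proof.
move=> r_inj u u' uu'.
case: (boolP (u \in rdom r)) => ur; case: (boolP (u' \in rdom r)) => u'r.
- case/existsP: ur => v ruv; case/existsP: u'r => v' ruv'.
  move/eqP: uu'; rewrite (complete_in r_inj ruv) (complete_in r_inj ruv').
  by rewrite -(r_inj _ _ _ _ ruv ruv') => /eqP.
- by have := complete_outN r_inj u'r; rewrite -uu' complete_inN.
- by have := complete_outN r_inj ur; rewrite uu' complete_inN.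
- move: uu'; rewrite !complete_out // (set_nth_default u' u) ?complete_out_lt //.
  move/eqP; rewrite nth_uniq ?enum_uniq ?complete_out_lt //.
  by move/eqP/(index_inj u); apply; rewrite mem_enum.
Qed.

(** When the image of r is the domain of s, the order-preserving bijections between
the complements also compose: a point at rank k goes to rank k and again to
rank k. *)
Lemma complete_comp r s rs :
  partial_injection r -> partial_injection s -> partial_injection rs ->
  rimg r =i rdom s ->
  (forall u w, rs u w <-> exists2 v, r u v & s v w) ->
  complete rs =1 complete s \o complete r.
Proof.
move=> r_inj s_inj rs_inj r_s rsE u /=.
have rs_dom : rdom rs =i rdom r.
  move=> x; apply/existsP/existsP=> [[w /rsE[v rxv _]]|[v rxv]]; first by exists v.
  have : v \in rimg r by apply/existsP; exists x.
  by rewrite r_s => /existsP[w svw]; exists w; apply/rsE; exists v.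
have rs_img : rimg rs =i rimg s.
  move=> x; apply/existsP/existsP=> [[w /rsE[v _ svx]]|[v svx]]; first by exists v.
  have : v \in rdom s by apply/existsP; exists x.
  by rewrite -r_s => /existsP[w rwv]; exists w; apply/rsE; exists v.
case: (boolP (u \in rdom r)) => ur.
  move: (ur); rewrite -rs_dom => /existsP[w rsuw].
  have [v ruv svw] := (rsE _ _).1 rsuw.
  by rewrite (complete_in rs_inj rsuw) (complete_in r_inj ruv) (complete_in s_inj svw).
have compl_eq (P Q : pred T) : P =i Q -> enum (predC P) = enum (predC Q).
  by move=> PQ; apply: eq_enum => x; rewrite !inE -[P x]/(x \in P) PQ.
have vs : complete r u \notin rdom s by rewrite -r_s complete_outN.
rewrite complete_out ?rs_dom // (complete_out vs).
rewrite (compl_eq _ _ rs_dom) (compl_eq _ _ rs_img).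
rewrite {2}complete_out // (compl_eq _ _ r_s) index_uniq ?enum_uniq //; last first.
  by rewrite -(compl_eq _ _ r_s) complete_out_lt.
apply: set_nth_default.
by rewrite -(size_compl s_inj) -(compl_eq _ _ r_s) complete_out_lt.
Qed.

End PartialInjections.

(** * Systems of copies of a structure *)

Definition finite_type_structure L (V : finType)
    (R : forall n, rels L n -> set (n.-tuple V))
    (F : forall n, funs L n -> n.-tuple V -> set V) : structure L :=
  Structure (countableP [set: V]%classic) R F.

Section Systems.
Variables (L : language) (G : permgroup L) (A B0 : structure L) (coh : Prop).

(** The partial automorphisms of A act on the system through [ext], and [coh] is
the proposition under which this action is multiplicative; instances for False
and True treat the two halves of the theorem together.  The map [base] has
the trivial language part, so that a partial automorphism and its extension have
equal language parts. *)
Record system := System {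
  pts : finType;
  srel : forall n, rels L n -> set (n.-tuple pts);
  sfun : forall n, funs L n -> n.-tuple pts -> set pts;
  str := finite_type_structure srel sfun;
  edges : {set {set pts}};
  edge_chart : forall e, e \in edges ->
    exists2 phi : smap G A str, embedding phi & [set` e]%classic = range phi;
  proj : smap G str B0;
  proj_hom : homomorphism proj;
  proj_edge : forall e, e \in edges -> embeds_on proj [set` e]%classic;
  base : smap G A str;
  base_lang : mlang base = lid L;
  base_embedding : embedding base;
  base_edge : exists2 e, e \in edges & [set` e]%classic = range base;
  ext : forall S T : set A, smap G (induced S) (induced T) -> smap G str str;
  ext_auto : forall S T (f : smap G (induced S) (induced T)),
    partial_automorphism f -> automorphism (ext f);
  ext_edges : forall S T (f : smap G (induced S) (induced T)) e,
    partial_automorphism f -> e \in edges -> (ext f @: e)%SET \in edges;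
  ext_lang : forall S T (f : smap G (induced S) (induced T)),
    partial_automorphism f -> mlang (ext f) = mlang f;
  ext_base : forall S T (f : smap G (induced S) (induced T)),
    partial_automorphism f -> forall v, ext f (base (val v)) = base (val (f v));
  ext_comp : coh -> forall S T U (f : smap G (induced S) (induced T))
      (g : smap G (induced T) (induced U)),
    partial_automorphism f -> partial_automorphism g ->
    ext (mcomp g f) = mcomp (ext g) (ext f) }.

End Systems.

(** * Stability, adjacency and twists in a system *)

Lemma connect_homo (T U : finType) (r : rel T) (r' : rel U) (f : T -> U) :
  (forall x y, r x y -> r' (f x) (f y)) ->
  forall x y, connect r x y -> connect r' (f x) (f y).
Proof.
move=> f_homo x y /connectP[p]; elim: p x => [|z p IH] x /= => [_ ->|].
  exact: connect0.
move=> /andP[xz zp] yE; apply: connect_trans (connect1 (f_homo _ _ xz)) _.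
exact: IH zp yE.
Qed.

Lemma connect_ind (T : finType) (r : rel T) (P : T -> Prop) x y :
  P x -> (forall u v, P u -> r u v -> P v) -> connect r x y -> P y.
Proof.
move=> + Pr /connectP[p]; elim: p x => [|z p IH] x Px /= => [_ -> //|].
by move=> /andP[xz zp] yE; apply: IH zp yE; apply: Pr xz.
Qed.

Lemma imset_family_surj (T : finType) (g : T -> T) (F : {set {set T}}) :
  injective g -> (forall e, e \in F -> (g @: e)%SET \in F) ->
  forall e, e \in F -> exists2 e', e' \in F & e = (g @: e')%SET.
Proof.
move=> /imset_inj img_inj g_F e eF.
have imF : ((fun e' : {set T} => g @: e') @: F = F)%SET.
  apply/eqP; rewrite eqEcard (card_imset _ img_inj) leqnn andbT.
  by apply/fintype.subsetP => _ /imsetP[e' e'F ->]; apply: g_F.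
by move: eF; rewrite -{1}imF => /imsetP.
Qed.

(** Every tuple to which a function symbol applies is a single vertex. *)
Lemma unary_fun_ind L (T : Type) (P : forall n, funs L n -> n.-tuple T -> Prop) :
  unary_functions L -> (forall (F : funs L 1) x, P 1 F [tuple x]) ->
  forall n (F : funs L n) t, P n F t.
Proof.
move=> L_unary P1 n F t; have n1 := L_unary n F; subst n.
by case/tupleP: t => x t; rewrite (tuple0 t); exact: P1.
Qed.

Section SystemTheory.
Variables (L : language) (G : permgroup L) (A B0 : structure L) (coh : Prop).
Hypothesis L_unary : unary_functions L.
Variable X : system G A B0 coh.
Local Notation V := (pts X).
Implicit Types (x y : V) (S e : {set V}).

Definition arrow : rel V :=
  [rel x y | `[< exists F : funs L 1, sfun (s := X) F [tuple x] y >]].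

Definition stable S := forall x y, x \in S -> arrow x y -> y \in S.

Lemma stableP S : stable S <-> substructure (A := str X) G [set` S]%classic.
Proof.
split=> [S_st|/substructureP S_sub x y xS /asboolP[F Fxy]].
- apply/substructureP; apply: (unary_fun_ind L_unary) => F x /(_ ord0) /= xS y Fxy /=.
  by apply: (S_st x) => //; apply/asboolP; exists F.
- by apply: (S_sub 1 F [tuple x]) => // i; rewrite (ord1 i).
Qed.

Lemma stable_connect S x y : stable S -> x \in S -> connect arrow x y -> y \in S.
Proof.
by move=> S_st xS; apply: (connect_ind (P := fun z => z \in S)) => // u v; apply: S_st.
Qed.

Lemma edge_stable e : e \in edges X -> stable e.
Proof.
move=> /edge_chart[phi [_ _ phiF] eE] x y xe /asboolP[F Fxy].
have : range phi x by rewrite -eE.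
move=> [a _ ax]; have := phiF _ (lfun (linv (mlang phi)) F) [tuple a].
rewrite lfunKV => Fa; suff : range phi y by rewrite -eE.
have : (phi @` fint (lfun (linv (mlang phi)) F) [tuple a])%classic y.
  rewrite Fa; congr (sfun F _ y) : Fxy.
  by apply: val_inj; rewrite /= ax.
by case=> b _ <-; exists b.
Qed.

Definition adj : rel V := [rel x y | [exists e in edges X, (x \in e) && (y \in e)]].

Lemma adjP x y : reflect (exists2 e, e \in edges X & x \in e /\ y \in e) (adj x y).
Proof.
apply: (iffP existsP) => [[e /andP[eX /andP[xe ye]]]|[e eX [xe ye]]].
  by exists e.
by exists e; rewrite eX xe ye.
Qed.

Lemma adj_sym x y : adj x y = adj y x.
Proof. by apply/adjP/adjP => -[e eX [xe ye]]; exists e. Qed.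

(** Edges are stable, so adjacency to y passes to the values of functions at y. *)
Lemma adj_arrow x y z : adj x y -> arrow y z -> adj x z.
Proof.
move=> /adjP[e eX [xe ye]] yz; apply/adjP; exists e => //; split=> //.
exact: edge_stable yz.
Qed.

Definition clique S := forall x y, x \in S -> y \in S -> adj x y.

Section Twists.
Variable q : nat.
Local Notation twist := ({set V} * {set V * V})%type.
Implicit Types (D : {set V}) (i : twist).

(** A pair i stands for a set of vertices with a relation on it; the twists are the
[valid] pairs.  Being a kernel, what c realizes is unchanged when its values are
permuted. *)
Definition realizes D i (c : V -> 'I_q.+1) :=
  forall x y, x \in D -> y \in D -> x \in i.1 -> y \in i.1 ->
    (c x == c y) = ((x, y) \in i.2).

Definition valid i := forall e, e \in edges X -> exists c, realizes e i c.

Lemma realizes_perm D i (c : V -> 'I_q.+1) (s : 'I_q.+1 -> 'I_q.+1) :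
  injective s -> realizes D i c -> realizes D i (s \o c).
Proof.
by move=> s_inj c_i x y xD yD xi yi; rewrite /= (inj_eq s_inj) c_i.
Qed.

End Twists.

Lemma arrow1 (F : funs L 1) x y : sfun (s := X) F [tuple x] y -> arrow x y.
Proof. by move=> Fxy; apply/asboolP; exists F. Qed.

End SystemTheory.

Section Covering.
Variables (L : language) (G : permgroup L) (A B0 : structure L) (coh : Prop).

Definition covered (X : system G A B0 coh) :=
  (forall x : pts X, exists2 e, e \in edges X & x \in e) /\
  (forall n (R : rels L n) t, srel (s := X) R t ->
     exists2 e, e \in edges X & forall k, tnth t k \in e).

(** What the covering construction achieves.  [covering_pigeonhole] comes from the
twists whose relation is equality, [covering_twist] from all twists: sections
assign values to the lifts of vertices, and along adjacent lifts these values
realize the twist. *)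
Record covering q (X Y : system G A B0 coh) (p : smap G (str Y) (str X)) : Prop :=
  Covering {
  covering_covered : covered Y;
  covering_emb : forall E, E \in edges Y -> embeds_on p [set` E]%classic;
  covering_edge : forall E, E \in edges Y ->
    exists2 e, e \in edges X & (p @: E)%SET \subset e;
  covering_stable : forall S : {set pts Y}, stable S -> stable (X := X) (p @: S)%SET;
  covering_clique : forall S e, stable S -> clique S -> e \in edges X ->
    (p @: S)%SET \subset e -> exists2 E, E \in edges Y & S \subset E;
  covering_pigeonhole : forall S, stable S -> clique S -> #|S| = q.+2 ->
    exists2 e, e \in edges X & (p @: S)%SET \subset e;
  covering_twist : forall S : {set pts Y},
    {in S &, forall u v, adj (X := X) (p u) (p v) -> adj u v} ->
    forall i, valid (X := X) q i -> exists c : pts X -> 'I_q.+1,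
    {in p @: S &, forall x y, adj x y -> x \in i.1 -> y \in i.1 ->
      (c x == c y) = ((x, y) \in i.2)} }.

End Covering.

(** * The covering of a system that unwinds all its twists *)

Section Cover.
Variables (L : language) (G : permgroup L) (A B0 : structure L) (coh : Prop).
Hypothesis L_unary : unary_functions L.
Variables (X : system G A B0 coh) (q : nat).
Local Notation V := (pts X).
Local Notation twist := ({set V} * {set V * V})%type.
Local Notation section := {ffun twist -> {ffun V -> 'I_q.+1}}.
Local Notation arr := (@arrow _ _ _ _ _ X).
Implicit Types (x y : V) (e D : {set V}) (i j : twist) (chi : section).

Definition lifting D chi := forall i, valid q i -> realizes D i (chi i).

(** The values of a section that a vertex over x remembers are those at the points
y of the closure of x, for the twists whose support contains y. *)
Definition relevant x i y := [&& `[< valid q i >], connect arr x y & y \in i.1].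

(** Irrelevant values are set to a constant, so that two sections have the same germ
at x exactly when they agree on the relevant values. *)
Definition germ x chi : section :=
  [ffun i => [ffun y => if relevant x i y then chi i y else ord0]].

Lemma germE x chi i y : relevant x i y -> germ x chi i y = chi i y.
Proof. by rewrite !ffunE => ->. Qed.

Lemma germP x chi chi' :
  germ x chi = germ x chi' <-> forall i y, relevant x i y -> chi i y = chi' i y.
Proof.
split=> [eq_germ i y xiy|eq_chi]; first by rewrite -(germE chi xiy) eq_germ germE.
apply/ffunP => i; apply/ffunP => y; rewrite !ffunE.
by case: ifP => // /eq_chi.
Qed.

Lemma relevant_trans x y i z : connect arr x y -> relevant y i z -> relevant x i z.
Proof.
by move=> xy /and3P[vi yz zi]; apply/and3P; split=> //; apply: connect_trans xy yz.
Qed.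

Lemma germ_germ x y chi : connect arr x y -> germ y (germ x chi) = germ y chi.
Proof. by move=> xy; apply/germP => i z /(relevant_trans xy) /germE->. Qed.

(** For each twist, a map realizing it on the whole edge has on D the same kernel as
the given section, so a permutation of the values makes them agree there. *)
Lemma lifting_extend D e chi : e \in edges X -> D \subset e -> lifting D chi ->
  exists2 chi', lifting e chi' &
    forall i x, valid q i -> x \in D -> x \in i.1 -> chi' i x = chi i x.
Proof.
move=> eX /fintype.subsetP De chi_D.
have ext_i i : exists c : {ffun V -> 'I_q.+1}, valid q i -> realizes e i c /\
    forall x, x \in D -> x \in i.1 -> c x = chi i x.
  have [vi|] := pselect (valid q i); last by exists [ffun => ord0].
  have [c c_e] := vi e eX.
  pose r : rel 'I_q.+1 := [rel u v | `[< exists x,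
    [/\ x \in D, x \in i.1, u = c x & v = chi i x] >]].
  have r_inj : partial_injection r.
    move=> u v u' v' /asboolP[x [xD xi -> ->]] /asboolP[y [yD yi -> ->]].
    by rewrite (chi_D i vi) // c_e //; apply: De.
  exists [ffun x => complete r (c x)] => _; split=> [x y xe ye xi yi|x xD xi].
    by rewrite !ffunE (inj_eq (complete_inj r_inj)) c_e.
  by rewrite ffunE; apply: complete_in => //; apply/asboolP; exists x.
have [f fP] := choice ext_i.
exists (finfun f) => [i vi|i x vi xD xi].
  by rewrite ffunE; have [] := fP i vi.
by rewrite ffunE; have [_ ->] := fP i vi.
Qed.

Lemma lifting_exists e : e \in edges X -> exists chi, lifting e chi.
Proof.
move=> eX.
have lift0 : lifting finset.set0 ([ffun=> [ffun=> ord0]] : section).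
  by move=> i _ x y; rewrite inE.
by have [chi chi_e _] := lifting_extend eX (finset.sub0set e) lift0; exists chi.
Qed.

(** Only germs of sections over edges are kept, so that every vertex of the covering
lies in an edge. *)
Definition lifted (p : V * section) :=
  `[< exists e chi, [/\ e \in edges X, lifting e chi, p.1 \in e & p.2 = germ p.1 chi] >].

Definition cover_pt := {p : V * section | lifted p}.
Implicit Types u v : cover_pt.

Definition pt u : V := (val u).1.
Definition sc u : section := (val u).2.

Lemma cover_pt_eq u v : pt u = pt v -> sc u = sc v -> u = v.
Proof.
move=> ptuv scuv; apply: val_inj.
by rewrite [val u]surjective_pairing [val v]surjective_pairing -/(pt u) -/(sc u) ptuv scuv.
Qed.

Lemma cover_ptP u : exists e chi,
  [/\ e \in edges X, lifting e chi, pt u \in e & sc u = germ (pt u) chi].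
Proof. by have /asboolP := valP u. Qed.

Definition edge_lift e chi : {set cover_pt} :=
  [set u | (pt u \in e) && (sc u == germ (pt u) chi)].

Lemma edge_liftP e chi u :
  reflect (pt u \in e /\ sc u = germ (pt u) chi) (u \in edge_lift e chi).
Proof. by rewrite inE; apply: (iffP andP) => -[? /eqP]. Qed.

Lemma lift_pt e chi x : e \in edges X -> lifting e chi -> x \in e ->
  exists2 u, u \in edge_lift e chi & pt u = x.
Proof.
move=> eX chi_e xe; have H : lifted (x, germ x chi) by apply/asboolP; exists e, chi.
by exists (Sub (x, germ x chi) H : cover_pt); rewrite ?inE /pt /sc SubK ?xe ?eqxx.
Qed.

Definition cover_edges : {set {set cover_pt}} :=
  [set E | `[< exists e chi, [/\ e \in edges X, lifting e chi & E = edge_lift e chi] >]].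

Lemma cover_edgesP E : reflect
  (exists e chi, [/\ e \in edges X, lifting e chi & E = edge_lift e chi])
  (E \in cover_edges).
Proof. by rewrite inE; apply: asboolP. Qed.

Definition cover_rel n (R : rels L n) : set (n.-tuple cover_pt) := fun t =>
  srel (s := X) R (map_tuple pt t) /\
  exists2 E, E \in cover_edges & forall k, tnth t k \in E.

(** The lift of a value of a function inherits its germ from the argument; this is
possible because its closure is contained in the closure of the argument. *)
Definition cover_fun n (F : funs L n) (t : n.-tuple cover_pt) : set cover_pt := fun v =>
  sfun (s := X) F (map_tuple pt t) (pt v) /\
  exists k, sc v = germ (pt v) (sc (tnth t k)).

Definition cover_str := finite_type_structure cover_rel cover_fun.

Lemma pt_inj_edge E : E \in cover_edges -> {in E &, injective pt}.
Proof.
move=> /cover_edgesP[e [chi [_ _ ->]]] u v /edge_liftP[_ su] /edge_liftP[_ sv] uv.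
by apply: cover_pt_eq => //; rewrite su sv uv.
Qed.

Definition cover_proj : smap G cover_str (str X) := @SMap _ G cover_str (str X) _ (pg1 G) pt.

Lemma cover_proj_hom : homomorphism cover_proj.
Proof.
split=> [n R t [] //|n F t v [u [Fu _] <-]].
exact: Fu.
Qed.

Lemma edge_lift_arrow e chi u y : e \in edges X -> lifting e chi ->
  u \in edge_lift e chi -> arr (pt u) y ->
  exists v, [/\ v \in edge_lift e chi, pt v = y & sc v = germ y (sc u)].
Proof.
move=> eX chi_e /edge_liftP[ue su] uy.
have ye : y \in e by apply: edge_stable uy.
have [v ve vy] := lift_pt eX chi_e ye; exists v; split=> //.
have /edge_liftP[_ ->] := ve; rewrite vy su germ_germ //.
exact: connect1.
Qed.

Lemma arrow_lift u y : arr (pt u) y ->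
  exists2 v, pt v = y & sc v = germ y (sc u).
Proof.
move=> uy; have [e [chi [eX chi_e ue su]]] := cover_ptP u.
have [|v [_ vy sv]] := edge_lift_arrow eX chi_e _ uy; first exact/edge_liftP.
by exists v.
Qed.

Lemma cover_proj_edge E : E \in cover_edges -> embeds_on cover_proj [set` E]%classic.
Proof.
move=> EX; have /cover_edgesP[e [chi [eX chi_e EE]]] := EX.
split=> [u v /= uE vE|n R t tE|]; first exact: pt_inj_edge EX u v uE vE.
- by split=> [[]|Rt] //; split=> //; exists E.
- apply: (unary_fun_ind L_unary) => F u /(_ ord0) uE.
  have {}uE : u \in edge_lift e chi by rewrite -EE.
  apply/seteqP; split=> [_ [v [Fv _] <-] //|y Fy].
  have Fuy : sfun (s := X) F [tuple pt u] y by rewrite -map_tuple1.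
  have [v vy sv] := arrow_lift (arrow1 Fuy).
  exists v => //; split; last by exists ord0; rewrite vy.
  by rewrite vy map_tuple1.
Qed.

(** A section over an edge lifts the whole copy of A isomorphically. *)
Lemma chart_lift e chi (phi : smap G A (str X)) :
  e \in edges X -> lifting e chi -> embedding phi -> [set` e]%classic = range phi ->
  exists psi : smap G A cover_str,
    [/\ mlang psi = mlang phi, forall a, pt (psi a) = phi a,
        forall a, sc (psi a) = germ (phi a) chi, embedding psi &
        [set` edge_lift e chi]%classic = range psi].
Proof.
move=> eX chi_e [phi_inj phiR phiF] eE.
have phi_e a : phi a \in e.
  by have : range phi (phi a) by [exists a]; rewrite -eE.
have lift a : exists u : cover_pt, pt u = phi a /\ sc u = germ (phi a) chi.
  have [u /edge_liftP[_ su] ua] := lift_pt eX chi_e (phi_e a).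
  by exists u; rewrite su ua.
have [psi psiP] := choice lift.
have pt_psi a := (psiP a).1; have sc_psi a := (psiP a).2.
have psi_e a : psi a \in edge_lift e chi.
  by apply/edge_liftP; rewrite pt_psi sc_psi.
have eX' : edge_lift e chi \in cover_edges by apply/cover_edgesP; exists e, chi.
exists (@SMap _ G A cover_str _ (mlangP phi) psi); split=> //.
- split=> [a b /= ab|n R t|].
  + by apply: phi_inj; rewrite -!pt_psi ab.
  + rewrite phiR /= /cover_rel /= map_tuple_comp.
    rewrite (@eq_in_map_tuple _ _ _ (pt \o psi) phi); last by move=> k; apply: pt_psi.
    split=> [Rt|[]//]; split=> //.
    by exists (edge_lift e chi) => // k; rewrite tnth_map.
  + apply: (unary_fun_ind L_unary) => F a.
    rewrite map_tuple1; apply/seteqP; split=> [_ [b Fab <-]|w [Faw [k]]].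
      have Fphi : sfun (s := X) (lfun (mlang phi) F) [tuple phi a] (phi b).
        have : (phi @` fint F [tuple a])%classic (phi b) by exists b.
        by rewrite phiF map_tuple1.
      rewrite /= /cover_fun map_tuple1 !pt_psi; split=> //; exists ord0.
      rewrite sc_psi (tnth_nth (psi a)) /= sc_psi germ_germ //.
      exact: connect1 (arrow1 Fphi).
    have /= Fphi := phiF 1 F [tuple a].
    move: Faw; rewrite !map_tuple1 pt_psi in Fphi *; rewrite -Fphi => -[b Fab bw] wE.
    exists b => //; apply: cover_pt_eq; first by rewrite pt_psi.
    have Fb : sfun (s := X) (lfun (mlang phi) F) [tuple phi a] (phi b).
      by rewrite -Fphi; exists b.
    rewrite wE sc_psi (ord1 k) (tnth_nth (psi a)) /= sc_psi -bw germ_germ //.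
    exact: connect1 (arrow1 Fb).
- apply/seteqP; split=> [u|_ [a _ <-]]; last exact: psi_e.
  move=> /edge_liftP[ue su]; have : range phi (pt u) by rewrite -eE.
  move=> [a _ au]; exists a => //; apply: cover_pt_eq; first by rewrite pt_psi.
  by rewrite sc_psi su au.
Qed.

Section LiftAutomorphism.

(** The twist that g carries to j. *)
Definition pull (g : V -> V) j : twist :=
  ([set x | g x \in j.1], [set p | (g p.1, g p.2) \in j.2]).

(** The section carried along g; the values for the twist j are permuted by s j. *)
Definition transport (g : V -> V) (s : twist -> 'I_q.+1 -> 'I_q.+1) chi : section :=
  [ffun j => [ffun y => s j (chi (pull g j) (finv g y))]].

Definition glift (g : V -> V) s u : cover_pt :=
  insubd u (g (pt u), germ (g (pt u)) (transport g s (sc u))).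

Variables (g : smap G (str X) (str X)) (s : twist -> 'I_q.+1 -> 'I_q.+1).
Hypotheses (g_auto : automorphism g)
  (g_edges : forall e, e \in edges X -> (g @: e)%SET \in edges X)
  (s_inj : forall j, valid q j -> injective (s j)).

Let g_inj : injective (g : V -> V).
Proof. by case: g_auto => -[]. Qed.

Lemma edges_image e : e \in edges X -> exists2 e', e' \in edges X & e = (g @: e')%SET.
Proof. by move=> eX; apply: imset_family_surj. Qed.

Lemma arrow_auto x y : arr (g x) (g y) = arr x y.
Proof.
have [[_ _ gF] _] := g_auto.
apply/asboolP/asboolP => -[F].
  rewrite -(lfunKV (mlang g) F) -map_tuple1.
  rewrite -[sfun _ _]/(fint (s := str X) (lfun (mlang g) (lfun (linv (mlang g)) F))
    (map_tuple g [tuple x])) -gF.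
  by move=> [z Fz /g_inj zy]; exists (lfun (linv (mlang g)) F); rewrite -zy.
move=> Fxy; exists (lfun (mlang g) F); rewrite -map_tuple1.
rewrite -[sfun _ _]/(fint (s := str X) (lfun (mlang g) F) (map_tuple g [tuple x])) -gF.
by exists y.
Qed.

Lemma connect_auto x y : connect arr (g x) (g y) = connect arr x y.
Proof.
apply/idP/idP; last by apply: connect_homo => a b; rewrite arrow_auto.
rewrite -{2}(finv_f g_inj x) -{2}(finv_f g_inj y); apply: connect_homo => a b.
by rewrite -{1}(f_finv g_inj a) -{1}(f_finv g_inj b) arrow_auto.
Qed.

Lemma realizes_pull e j (c : V -> 'I_q.+1) :
  realizes e (pull g j) c -> realizes (g @: e)%SET j (c \o finv g).
Proof.
move=> c_e _ _ /imsetP[x xe ->] /imsetP[y ye ->] xj yj.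
by rewrite /= !finv_f // c_e // inE.
Qed.

Lemma valid_pull j : valid q (pull g j) <-> valid (X := X) q j.
Proof.
split=> [vj e /edges_image[e' e'X ->]|vj e eX].
  by have [c c_e] := vj e' e'X; exists (c \o finv g); apply: realizes_pull.
have [c c_e] := vj _ (g_edges eX); exists (c \o g) => x y xe ye.
by rewrite !inE => xj yj; rewrite /= c_e // imset_f.
Qed.

Lemma lifting_transport e chi : lifting e chi -> lifting (g @: e)%SET (transport g s chi).
Proof.
move=> chi_e j vj; have vpj := (valid_pull j).2 vj.
have := realizes_perm (s_inj vj) (realizes_pull (chi_e _ vpj)).
by move=> r x y xe ye xj yj; rewrite !ffunE r.
Qed.

Lemma relevant_pull x j y : relevant (g x) j (g y) = relevant x (pull g j) y.
Proof.
rewrite /relevant connect_auto inE; congr (_ && _).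
by apply: asbool_equiv_eq; split=> /valid_pull.
Qed.

(** As g preserves closures, the germ of the transported section depends only on the
germ of the section. *)
Lemma germ_transport x chi :
  germ (g x) (transport g s (germ x chi)) = germ (g x) (transport g s chi).
Proof.
apply/germP => j y; rewrite -(f_finv g_inj y) relevant_pull => xjy.
by rewrite !ffunE finv_f // xjy.
Qed.

Lemma glift_val u : val (glift g s u) = (g (pt u), germ (g (pt u)) (transport g s (sc u))).
Proof.
apply: insubdK; have [e [chi [eX chi_e ue su]]] := cover_ptP u.
apply/asboolP; exists (g @: e)%SET, (transport g s chi); split=> //=.
- exact: g_edges.
- exact: lifting_transport.
- exact: imset_f.
- by rewrite su germ_transport.
Qed.

Lemma pt_glift u : pt (glift g s u) = g (pt u).
Proof. by rewrite /pt glift_val. Qed.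

Lemma sc_glift u : sc (glift g s u) = germ (g (pt u)) (transport g s (sc u)).
Proof. by rewrite /sc glift_val. Qed.

Lemma sc_id u : germ (pt u) (sc u) = sc u.
Proof. by have [e [chi [_ _ _ ->]]] := cover_ptP u; rewrite germ_germ ?connect0. Qed.

Lemma pull_surj i : exists j, i = pull g j.
Proof.
exists (g @: i.1, [set (g p.1, g p.2) | p in i.2])%SET.
have g2_inj : injective (fun p : V * V => (g p.1, g p.2)).
  by move=> [a b] [c d] /= [/g_inj-> /g_inj->].
case: i => i1 i2; congr (_, _); apply/setP => x; rewrite inE /=.
  by rewrite (mem_imset _ _ g_inj).
by rewrite (mem_imset _ x g2_inj).
Qed.

(** All relevant values are recovered since every twist is pulled back from some
twist and each s j is injective. *)
Lemma glift_inj : injective (glift g s).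
Proof.
move=> u v uv; have ptuv : pt u = pt v by apply: g_inj; rewrite -!pt_glift uv.
apply: cover_pt_eq => //; have := congr1 sc uv.
rewrite !sc_glift -ptuv => /germP H; rewrite -(sc_id u) -(sc_id v) -ptuv.
apply/germP => i y xiy; have [j ij] := pull_surj i; subst i.
have vj : valid q j by apply/valid_pull; have /and3P[/asboolP] := xiy.
have := H j (g y); rewrite relevant_pull => /(_ xiy).
by rewrite !ffunE finv_f // => /(s_inj vj).
Qed.

Lemma glift_edge_lift e chi : e \in edges X -> lifting e chi ->
  (glift g s @: edge_lift e chi)%SET = edge_lift (g @: e)%SET (transport g s chi).
Proof.
move=> eX chi_e; apply/setP => w; apply/imsetP/edge_liftP.
  move=> [u /edge_liftP[ue su] ->]; rewrite pt_glift; split; first exact: imset_f.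
  by rewrite sc_glift su germ_transport.
move=> [/imsetP[x xe wx] sw]; have [u ue ux] := lift_pt eX chi_e xe.
exists u => //; have /edge_liftP[_ su] := ue.
apply: cover_pt_eq; first by rewrite pt_glift ux.
by rewrite sc_glift su sw germ_transport ux wx.
Qed.

Lemma glift_edges E : E \in cover_edges -> (glift g s @: E)%SET \in cover_edges.
Proof.
move=> /cover_edgesP[e [chi [eX chi_e ->]]]; apply/cover_edgesP.
exists (g @: e)%SET, (transport g s chi); split; first exact: g_edges.
  exact: lifting_transport.
exact: glift_edge_lift.
Qed.

Lemma cover_edges_image E : E \in cover_edges ->
  exists2 E', E' \in cover_edges & E = (glift g s @: E')%SET.
Proof.
by move=> EX; apply: imset_family_surj => //; [exact: glift_inj | exact: glift_edges].
Qed.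

Definition glift_map : smap G cover_str cover_str :=
  @SMap _ G cover_str cover_str _ (mlangP g) (glift g s).

Lemma map_pt_glift n (t : n.-tuple cover_pt) :
  map_tuple pt (map_tuple (glift g s) t)
  = map_tuple g (map_tuple pt t).
Proof. by apply: eq_from_tnth => k; rewrite !tnth_map pt_glift. Qed.

Lemma glift_auto : automorphism glift_map.
Proof.
have [[_ gR gF] _] := g_auto.
split; last by apply: injF_bij; apply: glift_inj.
split=> [|n R t|]; first exact: glift_inj.
- rewrite /= /cover_rel map_pt_glift.
  rewrite -[srel (lrel _ R) _]/(rint (s := str X) (lrel (mlang g) R)
    (map_tuple g (map_tuple pt t))) -gR.
  split=> -[Rt [E EX tE]]; split=> //.
    exists (glift g s @: E)%SET; first exact: glift_edges.
    by move=> k; rewrite tnth_map imset_f.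
  have [E' E'X EE'] := cover_edges_image EX; exists E' => // k.
  by have := tE k; rewrite tnth_map EE' (mem_imset _ _ glift_inj).
- apply: (unary_fun_ind L_unary) => F u; rewrite map_tuple1.
  apply/seteqP; split=> [_ [v [Fv [k sv]] <-]|w [Fw [k sw]]].
    have {}Fv : sfun (s := X) F [tuple pt u] (pt v) by rewrite -map_tuple1.
    rewrite /= /cover_fun map_tuple1 !pt_glift -map_tuple1; split.
      rewrite -[sfun _ _]/(fint (s := str X) (lfun (mlang g) F) (map_tuple g [tuple pt u])) -gF.
      by exists (pt v).
    exists ord0; rewrite (tnth_nth u) /= sc_glift.
    rewrite sv (ord1 k) (tnth_nth u) /= germ_transport sc_glift germ_germ //.
    by rewrite connect_auto; exact: connect1 (arrow1 Fv).
  move: Fw sw; rewrite map_tuple1 pt_glift -map_tuple1 (ord1 k) (tnth_nth u) /= => Fw sw.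
  have : (g @` fint (s := str X) F [tuple pt u])%classic (pt w) by rewrite gF.
  move=> [y Fy yw]; have uy := arrow1 Fy; have [v vy sv] := arrow_lift uy.
  exists v; first by split; [rewrite map_tuple1 vy|exists ord0; rewrite vy].
  apply: cover_pt_eq; first by rewrite pt_glift vy.
  rewrite sc_glift sw sv vy -yw germ_transport sc_glift germ_germ //.
  by rewrite connect_auto; exact: connect1.
Qed.

End LiftAutomorphism.

Section CoverSystem.
Implicit Types S T U : set A.

Variables (e0 : {set V}) (chi0 : section) (b : smap G A cover_str).
Hypotheses (e0X : e0 \in edges X) (e0E : [set` e0]%classic = range (base X))
  (chi0_e0 : lifting e0 chi0) (b_lang : mlang b = mlang (base X))
  (pt_b : forall a, pt (b a) = base X a)
  (sc_b : forall a, sc (b a) = germ (base X a) chi0)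
  (b_emb : embedding b)
  (b_range : [set` edge_lift e0 chi0]%classic = range b).

Lemma cover_edge_chart E : E \in cover_edges ->
  exists2 phi : smap G A cover_str, embedding phi & [set` E]%classic = range phi.
Proof.
move=> /cover_edgesP[e [chi [eX chi_e ->]]].
have [phi phi_emb phi_e] := edge_chart eX.
by have [psi [_ _ _ psi_emb psi_e]] := chart_lift eX chi_e phi_emb phi_e; exists psi.
Qed.

(** The lift of the extension of f must carry the base copy of A, whose section is
[chi0], to itself along f; this prescribes the permutation of the values of each
twist on the values that [chi0] takes on the domain of f. *)
Definition match_values S T (f : smap G (induced S) (induced T)) j : rel 'I_q.+1 :=
  [rel u v | `[< exists w : induced S, [/\ base X (val (f w)) \in j.1,
     u = chi0 (pull (ext X f) j) (base X (val w)) & v = chi0 j (base X (val (f w)))] >]].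

Definition cover_ext S T (f : smap G (induced S) (induced T)) : smap G cover_str cover_str :=
  glift_map (ext X f) (fun j => complete (match_values f j)).

Lemma base_e0 a : base X a \in e0.
Proof. by have : range (base X) (base X a) by [exists a]; rewrite -e0E. Qed.

Section OneMap.
Variables (S T : set A) (f : smap G (induced S) (induced T)).
Hypothesis f_auto : partial_automorphism f.
Let g := ext X f.
Let g_auto : automorphism g. Proof. exact: ext_auto. Qed.
Let g_edges e : e \in edges X -> (g @: e)%SET \in edges X.
Proof. exact: ext_edges. Qed.

(** The section [chi0] realizes both the twist j and its pullback, and the two kernels
correspond under f. *)
Lemma match_values_inj j : valid q j -> partial_injection (match_values f j).
Proof.
move=> vj; have vpj : valid q (pull g j) by apply/(valid_pull g_auto g_edges).
move=> u v u' v' /asboolP[w [wj -> ->]] /asboolP[w' [w'j -> ->]].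
have in_pull (z : induced S) :
    base X (val (f z)) \in j.1 -> base X (val z) \in (pull g j).1.
  by rewrite inE /g ext_base.
rewrite (chi0_e0 vj) ?base_e0 // (chi0_e0 vpj) ?base_e0 ?in_pull //.
by rewrite inE /= /g !ext_base.
Qed.

Let s_inj j : valid q j -> injective (complete (match_values f j)).
Proof. by move=> vj; apply/complete_inj/match_values_inj. Qed.

Lemma cover_ext_auto : automorphism (cover_ext f).
Proof. exact: glift_auto. Qed.

Lemma cover_ext_edges E : E \in cover_edges -> (cover_ext f @: E)%SET \in cover_edges.
Proof. exact: glift_edges. Qed.

(** The codomain of f is a substructure, so the closure of one of its vertices
consists of values of f. *)
Lemma range_stable y a : T a -> connect arr (base X a) y ->
  exists w : induced S, y = base X (val (f w)).
Proof.
move=> Ta; have [_ /substructureP T_sub [_ [f' _ f'K]]] := f_auto.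
have [_ _ bF] := base_embedding X.
have T_st c z : T c -> arr (base X c) z -> exists2 c', T c' & z = base X c'.
  move=> Tc /asboolP[F]; rewrite -(lfunKV (mlang (base X)) F) -map_tuple1.
  rewrite -[sfun _ _]/(fint (s := str X)
    (lfun (mlang (base X)) (lfun (linv (mlang (base X))) F)) (map_tuple (base X) [tuple c])).
  rewrite -bF.
  move=> [c' Fc <-]; exists c' => //; apply: T_sub Fc => k.
  by rewrite (ord1 k) (tnth_nth c).
move=> /connectP[p]; elim: p a Ta => [|z p IH] a Ta /= => [_ ->|].
  pose t : induced T := SigSub (mem_set Ta).
  by exists (f' t); rewrite f'K.
by move=> /andP[/(T_st _ _ Ta)[c Tc ->] cp] yE; apply: IH cp yE.
Qed.

Lemma cover_ext_base (v : induced S) : cover_ext f (b (val v)) = b (val (f v)).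
Proof.
have pt_eq : pt (cover_ext f (b (val v))) = pt (b (val (f v))).
  by rewrite (pt_glift g_auto g_edges s_inj) !pt_b ext_base.
apply: cover_pt_eq => //.
rewrite (sc_glift g_auto g_edges s_inj) pt_b !sc_b (germ_transport _ g_auto g_edges).
rewrite /g ext_base //; apply/germP => j y /and3P[/asboolP vj ay yj].
have [w yE] := range_stable (set_valP (f v)) ay.
rewrite !ffunE; apply: complete_in; first exact: match_values_inj.
apply/asboolP; exists w; rewrite -yE; split=> //.
congr (chi0 _ _); have [[g_inj _ _] _] := g_auto.
by rewrite yE -(ext_base X f_auto) (finv_f g_inj).
Qed.

End OneMap.

Lemma partial_automorphism_comp S T U (f : smap G (induced S) (induced T))
    (h : smap G (induced T) (induced U)) :
  partial_automorphism f -> partial_automorphism h ->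
  partial_automorphism (mcomp h f).
Proof.
move=> [S_sub T_sub [f_emb f_bij]] [_ U_sub [h_emb h_bij]]; split=> //.
by split; [exact: embedding_comp | exact: bij_comp].
Qed.

(** The prescribed partial injections compose because the codomain of f is the domain
of h, and then so do their completions. *)
Lemma cover_ext_comp : coh -> forall S T U (f : smap G (induced S) (induced T))
    (h : smap G (induced T) (induced U)),
  partial_automorphism f -> partial_automorphism h ->
  cover_ext (mcomp h f) = mcomp (cover_ext h) (cover_ext f).
Proof.
move=> c S T U f h f_auto h_auto.
have hf_auto := partial_automorphism_comp f_auto h_auto.
have ext_hf := ext_comp X c f_auto h_auto.
have fX := ext_auto X f_auto; have hX := ext_auto X h_auto.
have hfX := ext_auto X hf_auto.
have inj k (S' T' : set A) (l : smap G (induced S') (induced T')) :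
    partial_automorphism l -> valid q k -> injective (complete (match_values l k)).
  by move=> l_auto vk; apply/complete_inj/match_values_inj.
have glift_vals (S' T' : set A) (l : smap G (induced S') (induced T'))
    (l_auto : partial_automorphism l) u :
    val (cover_ext l u) = (ext X l (pt u), germ (ext X l (pt u))
      (transport (ext X l) (fun j => complete (match_values l j)) (sc u))).
  apply: (glift_val (ext_auto X l_auto)); first by move=> e; apply: ext_edges.
  by move=> k; apply: inj.
apply: smap_eq => [|u]; first by rewrite /= ext_hf.
apply: val_inj; rewrite glift_vals // [RHS]glift_vals //=.
have ptf : pt (cover_ext f u) = ext X f (pt u) by rewrite /pt glift_vals.
have scf : sc (cover_ext f u) = germ (ext X f (pt u))
    (transport (ext X f) (fun j => complete (match_values f j)) (sc u)).
  by rewrite /sc glift_vals.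
rewrite ptf scf (germ_transport _ hX) => [|e]; last exact: ext_edges.
rewrite ext_hf /=; congr (_, _); apply/germP => j y /and3P[/asboolP vj _ yj].
have [[f_inj _ _] _] := fX; have [[h_inj _ _] _] := hX.
have [[hf_inj _ _] _] := hfX.
rewrite !ffunE.
have -> : pull (mcomp (ext X h) (ext X f)) j = pull (ext X f) (pull (ext X h) j).
  by congr (_, _); apply/setP => x; rewrite !inE.
have -> : finv (mcomp (ext X h) (ext X f)) y = finv (ext X f) (finv (ext X h) y).
  rewrite ext_hf in hf_inj; apply: (hf_inj _ _).
  by rewrite (f_finv hf_inj) /= (f_finv f_inj) (f_finv h_inj).
have vpj : valid q (pull (ext X h) j).
  by apply/(valid_pull hX) => // e; apply: ext_edges.
have [_ _ [_ [f' _ f'K]]] := f_auto.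
apply: (complete_comp (match_values_inj f_auto vpj) (match_values_inj h_auto vj)).
- exact: match_values_inj.
- move=> r; apply/existsP/existsP => [[u' /asboolP[w [wj _ rE]]]|[v /asboolP[w [wj rE _]]]].
    exists (chi0 j (base X (val (h (f w))))); apply/asboolP; exists (f w); split=> //.
    by move: wj; rewrite inE ext_base.
  exists (chi0 (pull (ext X f) (pull (ext X h) j)) (base X (val (f' w)))).
  apply/asboolP; exists (f' w); rewrite f'K; split=> //.
  by rewrite inE ext_base.
- move=> r t; split=> [/asboolP[w /= [wj rE tE]]|].
    exists (chi0 (pull (ext X h) j) (base X (val (f w)))); apply/asboolP.
      exists w; split=> //; first by rewrite inE ext_base.
      rewrite rE; congr (chi0 _ _); rewrite ext_hf.
      by congr (_, _); apply/setP => x; rewrite !inE.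
    by exists (f w).
  move=> [r' /asboolP[w [wj rE r'E]] /asboolP[w' [w'j r'E' tE]]].
  apply/asboolP; exists w => /=; move: (wj); rewrite inE ext_base // => wj'; split=> //.
    rewrite rE; congr (chi0 _ _); rewrite ext_hf.
    by congr (_, _); apply/setP => x; rewrite !inE.
  rewrite tE; apply/eqP.
  have := match_values_inj h_auto vj (u := r') (v := t) (u' := r')
    (v' := chi0 j (base X (val (h (f w))))).
  rewrite eqxx tE => <- //; apply/asboolP; first by exists w'.
  by exists (f w).
Qed.

Lemma cover_proj_edges E : E \in cover_edges ->
  exists2 e, e \in edges X & forall u, u \in E -> pt u \in e.
Proof.
move=> /cover_edgesP[e [chi [eX _ ->]]]; exists e => // u.
by move=> /edge_liftP[].
Qed.

Lemma system_proj_hom : homomorphism (mcomp (proj X) cover_proj).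
Proof.
have [pR pF] := proj_hom X; have [cR cF] := cover_proj_hom.
split=> [n R t /cR/pR|n F t]; first by rewrite map_tuple_comp.
rewrite -image_comp => y [z Fz <-].
have {}Fz : sfun (s := X) F (map_tuple pt t) z by apply: (cF n F t).
have := pF n F (map_tuple pt t) (proj X z).
by rewrite map_tuple_comp; apply; exists z.
Qed.

Lemma system_proj_edge E : E \in cover_edges ->
  embeds_on (mcomp (proj X) cover_proj) [set` E]%classic.
Proof.
move=> EX; have [e eX Ee] := cover_proj_edges EX.
have := @embeds_on_comp _ G cover_str (str X) B0 [set` E]%classic [set` e]%classic
  (proj X) cover_proj Ee.
by apply; [exact: cover_proj_edge | exact: proj_edge].
Qed.

Lemma system_base_lang : mlang b = lid L.
Proof. by rewrite b_lang base_lang. Qed.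

Lemma system_base_edge : exists2 E, E \in cover_edges & [set` E]%classic = range b.
Proof.
by exists (edge_lift e0 chi0) => //; apply/cover_edgesP; exists e0, chi0.
Qed.

Lemma cover_ext_lang S T (f : smap G (induced S) (induced T)) :
  partial_automorphism f -> mlang (cover_ext f) = mlang f.
Proof. exact: ext_lang. Qed.

Definition cover_system : system G A B0 coh :=
  @System _ _ _ _ _ _ cover_rel cover_fun
    cover_edges cover_edge_chart _ system_proj_hom system_proj_edge b
    system_base_lang b_emb system_base_edge cover_ext
    cover_ext_auto (fun S T f E f_auto => @cover_ext_edges S T f f_auto E)
    cover_ext_lang cover_ext_base cover_ext_comp.

Let Y := cover_system.
Let ptS (S : {set cover_pt}) : {set V} := (pt @: S)%SET.

Lemma cover_adjP u v : adj (X := Y) u v -> exists e chi,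
  [/\ e \in edges X, lifting e chi, u \in edge_lift e chi & v \in edge_lift e chi].
Proof.
by move=> /adjP[E /cover_edgesP[e [chi [eX chi_e ->]]] [uE vE]]; exists e, chi.
Qed.

Lemma cover_adj_pt u v : adj (X := Y) u v -> pt u = pt v -> u = v.
Proof.
move=> /cover_adjP[e [chi [eX chi_e ue ve]]]; apply: @pt_inj_edge ue ve.
by apply/cover_edgesP; exists e, chi.
Qed.

Lemma cover_arrow u y : arr (pt u) y ->
  exists v, [/\ arrow (X := Y) u v, pt v = y & sc v = germ y (sc u)].
Proof.
move=> uy; have [v vy sv] := arrow_lift uy; exists v; split=> //.
have /asboolP[F Fuy] := uy; apply/asboolP; exists F; split.
  by rewrite map_tuple1 vy.
by exists ord0; rewrite vy.
Qed.

Lemma stable_arrow_lift (S : {set cover_pt}) u y : stable (X := Y) S -> u \in S ->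
  connect arr (pt u) y -> exists v, [/\ v \in S, pt v = y & sc v = germ y (sc u)].
Proof.
move=> S_st uS /connectP[r]; elim: r u uS => [|z r IH] u uS /= => [_ ->|].
  by exists u; rewrite sc_id.
move=> /andP[/cover_arrow[v [uv vz sv]] zr] yE; subst z.
have [w [wS wy sw]] := IH v (S_st _ _ uS uv) zr yE; exists w; split=> //.
rewrite sw sv germ_germ //; apply/connectP; by exists r.
Qed.

Lemma sc_adj u v i : adj (X := Y) u v -> valid q i -> pt u \in i.1 -> pt v \in i.1 ->
  (sc u i (pt u) == sc v i (pt v)) = ((pt u, pt v) \in i.2).
Proof.
move=> /cover_adjP[e [chi [eX chi_e /edge_liftP[ue ->] /edge_liftP[ve ->]]]] vi ui vi'.
have rel x : x \in i.1 -> relevant x i x.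
  by move=> xi; apply/and3P; split; rewrite ?connect0 //; apply/asboolP.
by rewrite !germE ?rel // chi_e.
Qed.

Definition section_of (S : {set cover_pt}) i x : 'I_q.+1 :=
  if [pick u in S | pt u == x] is Some u then sc u i x else ord0.

Lemma section_ofP (S : {set cover_pt}) x : x \in ptS S ->
  exists u, [/\ u \in S, pt u = x & forall i, section_of S i x = sc u i x].
Proof.
move=> /imsetP[u uS ->]; rewrite /section_of; case: pickP => [v /andP[vS /eqP <-]|].
  by exists v.
by move/(_ u); rewrite uS eqxx.
Qed.

Lemma cover_covered : covered Y.
Proof.
split=> [u|n R t []//].
have [e [chi [eX chi_e ue su]]] := cover_ptP u.
by exists (edge_lift e chi); [apply/cover_edgesP; exists e, chi | apply/edge_liftP].
Qed.

(** The germs over a stable clique are pairwise compatible and so define one section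
over its image, which extends to the edge e. *)
Lemma cover_clique (S : {set cover_pt}) e : stable (X := Y) S -> clique (X := Y) S ->
  e \in edges X -> ptS S \subset e -> exists2 E, E \in edges Y & S \subset E.
Proof.
move=> S_st S_cl eX Se.
pose chi : section := [ffun i => [ffun x => section_of S i x]].
have chiE i u : u \in S -> chi i (pt u) = sc u i (pt u).
  move=> uS; rewrite !ffunE.
  have [|v [vS vu ->]] := @section_ofP S (pt u); first exact: imset_f.
  by rewrite (cover_adj_pt (S_cl v u vS uS) vu).
have chi_S : lifting (ptS S) chi.
  move=> i vi _ _ /imsetP[u uS ->] /imsetP[v vS ->] ui vi'.
  by rewrite !chiE // sc_adj //; apply: S_cl.
have [chi' chi'_e chi'_S] := lifting_extend eX Se chi_S.
exists (edge_lift e chi'); first by apply/cover_edgesP; exists e, chi'.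
apply/fintype.subsetP => u uS; apply/edge_liftP; split.
  by apply: (fintype.subsetP Se); apply: imset_f.
rewrite -(sc_id u); apply/germP => i y /and3P[/asboolP vi uy yi].
have [v [vS vy sv]] := stable_arrow_lift S_st uS uy.
rewrite chi'_S // -vy ?imset_f ?vy //; rewrite -{2}vy chiE // vy sv germE //.
by apply/and3P; split; rewrite ?connect0 //; apply/asboolP.
Qed.

(** Otherwise no edge contains the image, and equality on the image is a twist: each
edge meets it in at most q + 1 points.  Then the q + 2 pairwise adjacent vertices
would have distinct values for this twist. *)
Lemma cover_pigeonhole (S : {set cover_pt}) : stable (X := Y) S -> clique (X := Y) S ->
  #|S| = q.+2 -> exists2 e, e \in edges X & ptS S \subset e.
Proof.
move=> S_st S_cl card_S; apply: contrapT => no_e.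
pose i : twist := (ptS S, [set p | p.1 == p.2]).
have card_D : #|ptS S| = q.+2.
  rewrite -card_S card_in_imset // => u v uS vS.
  exact/cover_adj_pt/S_cl.
have vi : valid q i.
  move=> e eX; pose D := ptS S :&: e.
  have card_De : #|D| <= q.+1.
    rewrite -ltnS -card_D; apply: proper_card; rewrite properE finset.subsetIl /=.
    apply/negP => SD; apply: no_e; exists e => //.
    by apply: fintype.subset_trans SD (finset.subsetIr _ _).
  exists (fun x => inord (index x (enum D))) => x y xe ye /= xS yS; rewrite inE /=.
  have lt z : z \in e -> z \in ptS S -> index z (enum D) < q.+1.
    move=> ze zS; apply: leq_trans card_De; rewrite cardE index_mem mem_enum.
    by rewrite inE zS.
  have De z : z \in e -> z \in ptS S -> z \in enum D.
    by move=> ze zS; rewrite mem_enum inE zS.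
  apply/eqP/eqP => [/(congr1 val)|->] //.
  by rewrite /= !inordK ?lt //; apply: (index_inj x); apply: De.
suff : q.+2 <= q.+1 by rewrite ltnn.
rewrite -[in X in X <= _]card_S -[in X in _ <= X](card_ord q.+1).
rewrite -(@card_in_imset _ _ (fun u => sc u i (pt u)) (mem S)) ?max_card //.
move=> u v uS vS /eqP; rewrite sc_adj ?imset_f //; last exact: S_cl.
by rewrite inE => /eqP; apply/cover_adj_pt/S_cl.
Qed.

Lemma cover_twist (S : {set cover_pt}) :
  {in S &, forall u v, adj (X := X) (pt u) (pt v) -> adj (X := Y) u v} ->
  forall i, valid (X := X) q i -> exists c : V -> 'I_q.+1,
    {in ptS S &, forall x y, adj x y -> x \in i.1 -> y \in i.1 ->
      (c x == c y) = ((x, y) \in i.2)}.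
Proof.
move=> S_adj i vi; exists (section_of S i) => x y.
move=> /section_ofP[u [uS <- ->]] /section_ofP[v [vS <- ->]] uv ui vi'.
by rewrite sc_adj //; apply: S_adj.
Qed.

Lemma cover_covering : covering (Y := Y) q cover_proj.
Proof.
split.
- exact: cover_covered.
- exact: cover_proj_edge.
- move=> E EX; have [e eX Ee] := cover_proj_edges EX; exists e => //.
  by apply/fintype.subsetP => _ /imsetP[u uE ->]; apply: Ee.
- move=> S S_st _ y /imsetP[u uS ->] /cover_arrow[v [uv <- _]].
  by apply/imset_f/(S_st u).
- exact: cover_clique.
- exact: cover_pigeonhole.
- exact: cover_twist.
Qed.

End CoverSystem.

End Cover.

Lemma covering_exists L (G : permgroup L) A B0 coh (X : system G A B0 coh) q :
  unary_functions L ->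
  exists (Y : system G A B0 coh) (p : smap G (str Y) (str X)), covering q p.
Proof.
move=> L_unary; have [e0 e0X e0E] := base_edge X.
have [chi0 chi0_e0] := lifting_exists q e0X.
have [b [b_lang pt_b sc_b b_emb b_range]] :=
  chart_lift L_unary e0X chi0_e0 (base_embedding X) e0E.
exists (cover_system L_unary e0X e0E chi0_e0 b_lang pt_b sc_b b_emb b_range).
by exists (cover_proj X q); apply: cover_covering.
Qed.

(** * Conformal systems and amalgamation along separators *)

Section Phases.
Variables (L : language) (G : permgroup L) (A B0 : structure L) (coh : Prop).
Hypothesis L_unary : unary_functions L.
Local Notation system := (system G A B0 coh).
Implicit Types X Y : system.

Lemma adj_refl X (x : pts X) : covered X -> adj x x.
Proof. by case=> X_cov _; have [e eX xe] := X_cov x; apply/adjP; exists e. Qed.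

Lemma arrow_adj X (x y : pts X) : covered X -> arrow x y -> adj x y.
Proof. by move=> X_cov; apply: adj_arrow; apply: adj_refl. Qed.

Definition conformal X :=
  forall S : {set pts X}, stable S -> clique S ->
    exists2 e, e \in edges X & S \subset e.

Section OneCovering.
Variables (q : nat) (X Y : system) (p : smap G (str Y) (str X)).
Hypothesis p_cov : covering q p.

Lemma covering_adj (u v : pts Y) : adj u v -> adj (X := X) (p u) (p v).
Proof.
move=> /adjP[E EY [uE vE]]; have [e eX /fintype.subsetP Ee] := covering_edge p_cov EY.
by apply/adjP; exists e => //; split; apply: Ee; apply: imset_f.
Qed.

Lemma covering_adj_inj (u v : pts Y) : adj u v -> p u = p v -> u = v.
Proof.
move=> /adjP[E EY [uE vE]]; have [p_inj _ _] := covering_emb p_cov EY.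
exact: p_inj.
Qed.

Lemma covering_clique_image (S : {set pts Y}) : clique S -> clique (X := X) (p @: S)%SET.
Proof.
move=> S_cl _ _ /imsetP[u uS ->] /imsetP[v vS ->].
exact/covering_adj/S_cl.
Qed.

Lemma covering_clique_card (S : {set pts Y}) : clique S -> #|(p @: S)%SET| = #|S|.
Proof.
by move=> S_cl; apply: card_in_imset => u v uS vS; exact/covering_adj_inj/S_cl.
Qed.

Lemma covering_conformal : conformal X -> conformal Y.
Proof.
move=> X_conf S S_st S_cl.
have [e eX Se] := X_conf _ (covering_stable p_cov S_st) (covering_clique_image S_cl).
exact: (covering_clique p_cov) Se.
Qed.

End OneCovering.

(** Cliques project injectively, so their size is bounded by the number of vertices
of X; the covering with q + 1 values takes care of cliques of size q + 2 and keeps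
what has been achieved for smaller ones. *)
Lemma conformal_exists X : exists Y, covered Y /\ conformal Y.
Proof.
pose N := #|pts X|.
have iter m : exists Y, [/\ covered Y,
    forall S : {set pts Y}, clique S -> #|S| <= N &
    forall S : {set pts Y}, stable S -> clique S -> 1 < #|S| < m.+2 ->
      exists2 e, e \in edges Y & S \subset e].
  elim: m => [|m [Y [Y_cov Y_bd Y_conf]]].
    have [Y [p p_cov]] := covering_exists X 0 L_unary; exists Y; split.
    - exact: covering_covered p_cov.
    - move=> S S_cl; rewrite -(covering_clique_card p_cov S_cl); exact: max_card.
    - by move=> S _ _ /andP[+ /ltnSE] => /leq_trans H /H.
  have [Z [p p_cov]] := covering_exists Y m L_unary; exists Z; split.
  - exact: covering_covered p_cov.
  - move=> S S_cl; rewrite -(covering_clique_card p_cov S_cl); apply: Y_bd.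
    exact: covering_clique_image p_cov _ S_cl.
  - move=> S S_st S_cl /andP[S_gt1]; rewrite ltnS leq_eqVlt => S_le.
    suff [e eY Se] : exists2 e, e \in edges Y & (p @: S)%SET \subset e.
      exact: (covering_clique p_cov) Se.
    case/predU1P: S_le => [|S_lt]; first exact: (covering_pigeonhole p_cov).
    apply: Y_conf; first exact: covering_stable p_cov _ S_st.
      exact: covering_clique_image p_cov _ S_cl.
    by rewrite (covering_clique_card p_cov S_cl) S_gt1.
have [Y [Y_cov Y_bd Y_conf]] := iter N; exists Y; split=> // S S_st S_cl.
(* Cliques with at most one vertex lie in an edge of any covered system. *)
have [S_gt1|] := ltnP 1 #|S|.
  by apply: Y_conf => //; rewrite S_gt1 /= !ltnS ltnW // ltnS Y_bd.
case: (set_0Vmem S) => [-> _|[x xS]].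
  by have [e eY _] := base_edge Y; exists e => //; apply: finset.sub0set.
move=> S_le1; have [e eY xe] := Y_cov.1 x; exists e => //.
apply/fintype.subsetP => y yS.
by have /card_le1_eqP S1 := S_le1; rewrite (S1 x y).
Qed.

Variable K : class L.
Hypotheses (K_hereditary : hereditary G K) (K_amalg : strong_amalgamation_property G K)
  (KA : K A).

(** This is stronger than having a completion in K when the edges contain
vertex sets that are not irreducible: they too are embedded.  It is needed to
amalgamate over a part of an edge. *)
Definition completable X (S : {set pts X}) :=
  exists2 C, K C & exists f : smap G (str X) C,
    forall e, e \in edges X -> embeds_on f [set` e :&: S]%classic.

Lemma completable_covering q X Y (p : smap G (str Y) (str X)) (S : {set pts Y}) :
  covering q p -> completable (X := X) (p @: S)%SET -> completable S.
Proof.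
move=> p_cov [C KC [f f_emb]]; exists C => //; exists (mcomp f p) => E EY.
have [e eX /fintype.subsetP Ee] := covering_edge p_cov EY.
have fp_emb := @embeds_on_comp _ G (str Y) (str X) C [set` E :&: S]%classic
  [set` e :&: (p @: S)%SET]%classic f p.
apply: fp_emb; last exact: f_emb.
  move=> u /setIP[uE uS] /=; apply/setIP; split; last exact: imset_f.
  exact/Ee/imset_f.
apply: embeds_on_sub (covering_emb p_cov EY) => u /setIP[uE _].
exact: uE.
Qed.

(** The vertices outside e are sent anywhere; there is somewhere to send them
because every vertex lies in a copy of A. *)
Lemma edge_retraction X e : covered X -> e \in edges X ->
  exists f : smap G (str X) A, embeds_on f [set` e]%classic.
Proof.
move=> X_cov eX; have [phi phi_emb phi_e] := edge_chart eX.
have inv (x : pts X) : exists a, forall a', phi a' = x -> a' = a.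
  have [phi_inj _ _] := phi_emb.
  case: (pselect (range phi x)) => [[a _ ax]|x_e].
    by exists a => a'; rewrite -ax => /phi_inj.
  have [e' e'X xe'] := X_cov.1 x; have [phi' _ phi'_e'] := edge_chart e'X.
  have [a _ _] : range phi' x by rewrite -phi'_e'.
  by exists a => a' a'x; case: x_e; exists a'.
have [g gP] := choice inv.
exists (@SMap _ G (str X) A _ (pgV (mlangP phi)) g); rewrite phi_e.
by apply: embeds_on_inverse => // a; rewrite -(gP _ a).
Qed.

(** No twist for two values obstructs lifting S to the covering with all its
adjacencies. *)
Definition flat X (S : {set pts X}) :=
  forall i, valid (X := X) 1 i -> exists c : pts X -> 'I_2,
    {in S &, forall x y, adj x y -> x \in i.1 -> y \in i.1 ->
      (c x == c y) = ((x, y) \in i.2)}.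

Lemma flat_sub X (S T : {set pts X}) : S \subset T -> flat T -> flat S.
Proof.
move=> /fintype.subsetP ST T_flat i vi; have [c c_i] := T_flat i vi; exists c.
by move=> x y /ST xT /ST yT; apply: c_i.
Qed.

Lemma stable_setI X (S T : {set pts X}) : stable S -> stable T -> stable (S :&: T)%SET.
Proof.
move=> S_st T_st x y /setIP[xS xT] xy; apply/setIP.
by split; [apply: S_st xy | apply: T_st xy].
Qed.

(** The completions of M1 and M2 restrict to embeddings of T, because T lies in an edge.
In their amalgam over T, each edge of M is embedded since it lies in M1 or in M2. *)
Lemma completable_amalgam X (M M1 M2 T : {set pts X}) :
  stable M -> stable T -> T \subset M1 -> T \subset M2 ->
  (forall x, x \in M1 -> x \in M2 -> x \in T) ->
  (exists2 e, e \in edges X & T \subset e) ->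
  (forall e, e \in edges X -> (e :&: M \subset M1) \/ (e :&: M \subset M2)) ->
  completable M1 -> completable M2 -> completable M.
Proof.
move=> M_st T_st /fintype.subsetP TM1 /fintype.subsetP TM2 M12 [eT eTX /fintype.subsetP TeT] e_M12.
move=> [C1 KC1 [f1 f1_emb]] [C2 KC2 [f2 f2_emb]].
have T_sub := (stableP L_unary T).1 T_st.
pose j1 := mcomp f1 (@inclusion L G (str X) [set` T]%classic).
pose j2 := mcomp f2 (@inclusion L G (str X) [set` T]%classic).
have j1_emb : embedding j1.
  apply/(embedding_inclusion f1 T_sub); apply: embeds_on_sub (f1_emb _ eTX) => x xT.
  by apply/setIP; split; [apply: TeT | apply: TM1].
have j2_emb : embedding j2.
  apply/(embedding_inclusion f2 T_sub); apply: embeds_on_sub (f2_emb _ eTX) => x xT.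
  by apply/setIP; split; [apply: TeT | apply: TM2].
have KT : K (induced (A := str X) [set` T]%classic).
  by apply: K_hereditary KC1 _; exists j1.
have [C [b1 [b2 [KC [[b1_emb b2_emb b12] _]]]]] := K_amalg KT KC1 KC2 j1_emb j2_emb.
exists C => //.
pose h x := if x \in M1 then b1 (f1 x) else b2 (f2 x).
pose f := @SMap _ G (str X) C _ (mlangP (mcomp b1 f1)) h.
have b12_lang : mlang (mcomp b2 f2) = mlang f.
  by have := congr1 (@mlang _ _ _ _) b12; rewrite /= !lcompg1.
have b12_T x : x \in T -> b1 (f1 x) = b2 (f2 x).
  move=> xT.
  have xT' : [set` T]%classic x by [].
  pose x' : induced (A := str X) [set` T]%classic := SigSub (mem_set xT').
  by have := congr1 (fun m : smap G (induced (A := str X) [set` T]%classic) C => m x') b12.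
have comp_emb (C' : structure L) (f' : smap G (str X) C') (b' : smap G C' C) (S : set (str X)) :
    embedding b' -> embeds_on f' S -> embeds_on (mcomp b' f') S.
  move=> /embedding_setT b'_emb f'_emb.
  exact: (embeds_on_comp (T := [set: C']%classic)).
exists f => e eX.
have eM_sub := (stableP L_unary _).1 (stable_setI (edge_stable eX) M_st).
have [/fintype.subsetP eM1|/fintype.subsetP eM2] := e_M12 e eX.
  apply: (@embeds_on_eq _ _ _ _ _ (mcomp b1 f1)) => //.
  - by move=> x /eM1 xM1; rewrite /= /h xM1.
  - by have /substructureP := eM_sub.
  - apply: comp_emb => //; apply: embeds_on_sub (f1_emb e eX) => x xeM.
    by have /setIP[xe xM] : x \in e :&: M by []; apply/setIP; split=> //; apply: eM1.
apply: (@embeds_on_eq _ _ _ _ _ (mcomp b2 f2)) => //.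
- move=> x /eM2 xM2; rewrite /= /h; case: ifP => // xM1.
  by rewrite b12_T // M12.
- by have /substructureP := eM_sub.
- apply: comp_emb => //; apply: embeds_on_sub (f2_emb e eX) => x xeM.
  by have /setIP[xe xM] : x \in e :&: M by []; apply/setIP; split=> //; apply: eM2.
Qed.

(** Induction on the size of M, by splitting M along the clique T that separates a
component C from the rest. *)
Lemma flat_completable X (M : {set pts X}) :
  covered X -> conformal X -> stable M -> flat M -> completable M.
Proof.
move=> X_cov X_conf; have [n] := ubnP #|M|; elim: n M => // n IH M leMn M_st M_flat.
have [M_cl|] := pselect (clique M).
  have [e eX Me] := X_conf M M_st M_cl.
  have [f f_emb] := edge_retraction X_cov eX.
  exists A => //; exists f => e' _; apply: embeds_on_sub f_emb => x /setIP[_].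
  exact: (fintype.subsetP Me).
move=> /existsNP[a] /existsNP[b] /not_implyP[aM] /not_implyP[bM] /negP ab.
have refl x : adj (X := X) x x by exact: adj_refl.
pose r : rel (pts X) := [rel x y | [&& x \in M, y \in M, ~~ adj a x, ~~ adj a y & adj x y]].
pose C := [set y | connect r b y].
pose T := [set y in M | (y \notin C) && [exists z in C, adj z y]].
have CP y : y \in C -> y \in M /\ ~~ adj a y.
  rewrite inE; apply: (connect_ind (P := fun y => y \in M /\ ~~ adj a y)) => //.
  by move=> u v _ /and5P[].
have C_ext x y : x \in C -> y \in M -> ~~ adj a y -> adj x y -> y \in C.
  move=> xC yM ay xy; have [xM ax] := CP x xC.
  move: xC; rewrite !inE => bx; apply: connect_trans bx (connect1 _).
  by apply/and5P.
have TP y : y \in T -> [/\ y \in M, y \notin C, adj a y & exists2 z, z \in C & adj z y].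
  rewrite inE => /and3P[yM yC /existsP[z /andP[zC zy]]]; split=> //; last by exists z.
  by apply: contraNT yC => ay; apply: C_ext zC yM ay zy.
have TI y z : y \in M -> y \notin C -> z \in C -> adj z y -> y \in T.
  by move=> yM yC zC zy; rewrite inE yM yC /=; apply/existsP; exists z; rewrite zC.
have aC : a \notin C by apply/negP => /CP[_]; rewrite refl.
have aT : a \notin T.
  by apply/negP => /TP[_ _ _ [z /CP[_ +]]]; rewrite adj_sym => /negP.
have bC : b \in C by rewrite inE connect0.
pose M1 := C :|: T; pose M2 := M :\: C.
(* Values of functions at a vertex of T are adjacent to a, hence outside C, and to C. *)
have T_up x y : x \in T -> arrow x y -> y \in T.
  move=> xT xy; have [xM xC ax [z zC zx]] := TP x xT.
  have ay := adj_arrow ax xy; apply: TI zC _; first exact: M_st xy.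
    by apply/negP => /CP[_]; rewrite ay.
  exact: adj_arrow xy.
have M1_st : stable M1.
  move=> x y /setUP[xC|xT] xy; apply/setUP; last by right; apply: T_up xy.
  have [yC|yC] := boolP (y \in C); [by left | right].
  have [xM _] := CP x xC; apply: TI yC xC _; first exact: M_st xy.
  exact: arrow_adj.
have M2_st : stable M2.
  move=> x y /setDP[xM xC] xy; apply/setDP; split; first exact: M_st xy.
  apply/negP => yC; have : y \in T.
    by apply: (T_up x) => //; apply: TI yC _ => //; rewrite adj_sym; apply: arrow_adj.
  by move=> /TP[_]; rewrite yC.
have TM1 : T \subset M1 by apply: finset.subsetUr.
have TM2 : T \subset M2.
  by apply/fintype.subsetP => x /TP[xM xC _ _]; apply/setDP.
have M1M : M1 \subset M.
  by apply/fintype.subsetP => x /setUP[/CP[]|/TP[]].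
have M2M : M2 \subset M by apply: finset.subsetDl.
have lt1 : #|M1| < n.
  rewrite -ltnS; apply: leq_trans leMn; rewrite ltnS; apply: proper_card.
  apply/fintype.properP; split=> //; exists a => //.
  by rewrite inE (negPf aC) (negPf aT).
have lt2 : #|M2| < n.
  rewrite -ltnS; apply: leq_trans leMn; rewrite ltnS; apply: proper_card.
  by apply/fintype.properP; split=> //; exists b => //; rewrite inE bC.
have T_cl : clique T.
  move=> u v uT vT; apply: contrapT => /negP uv.
  have [uM uC au [zu zuC zuu]] := TP u uT; have [vM vC av [zv zvC zvv]] := TP v vT.
  have ua : u != a by apply: contraTneq uT => ->.
  have va : v != a by apply: contraTneq vT => ->.
  have vu : v != u by apply: contraNneq uv => ->.
  (* No edge contains both u and v, or both a and a vertex of C; so on an edge the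
     relation is the kernel of the indicator of u if a lies in it, and of a
     constant map otherwise. *)
  pose W := [set a; u; v] :|: C.
  pose i := (W, [set p : pts X * pts X | (p != (a, u)) && (p != (u, a))]).
  have vi : valid (X := X) 1 i.
    move=> e eX; exists (fun x => inord ((x == u) && (a \in e))) => x y xe ye.
    have adj_e z w : z \in e -> w \in e -> adj z w by move=> ? ?; apply/adjP; exists e.
    have inordE (b1 b2 : bool) : (inord b1 == inord b2 :> 'I_2) = (b1 == b2).
      apply/eqP/eqP => [/(congr1 val)|->] //.
      by rewrite /= !inordK; case: b1; case: b2.
    have [ae|ae] := boolP (a \in e); last first.
      move=> _ _; rewrite inordE !andbF eqxx !inE !xpair_eqE.
      have -> : (x == a) = false by apply: contraNF ae => /eqP <-.
      have -> : (y == a) = false by apply: contraNF ae => /eqP <-.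
      by rewrite andbF.
    have notC z : z \in e -> z \notin C.
      by move=> ze; apply/negP => /CP[_]; rewrite adj_e.
    rewrite !andbT inordE => xW yW.
    have memW z : z \in e -> z \in W -> [\/ z = a, z = u | z = v].
      move=> ze; rewrite 2!inE (negPf (notC z ze)) orbF !inE.
      by move=> /orP[/orP[]|] /eqP ->; [apply: Or31|apply: Or32|apply: Or33].
    have [ue|ue] := boolP (u \in e); last first.
      have -> : (x == u) = false by apply: contraNF ue => /eqP <-.
      have yu : (y == u) = false by apply: contraNF ue => /eqP <-.
      have xu : (x == u) = false by apply: contraNF ue => /eqP <-.
      by rewrite yu inE !xpair_eqE yu xu andbF.
    have ve : v \notin e by apply: contraNN uv => ve; apply: adj_e.
    have au_ne : (a == u) = false by rewrite eq_sym (negPf ua).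
    have au2 z : z \in e -> z \in W -> z = a \/ z = u.
      move=> ze /(memW z ze)[->|->|z_v]; [by left|by right|].
      by move: ve; rewrite -z_v ze.
    rewrite inE !xpair_eqE.
    case: (au2 x xe xW) => ->; case: (au2 y ye yW) => ->;
      by rewrite ?eqxx ?au_ne ?(negPf ua).
  have [c c_i] := M_flat i vi.
  have aW : a \in i.1 by rewrite !inE eqxx.
  have uW : u \in i.1 by rewrite !inE eqxx orbT.
  have vW : v \in i.1 by rewrite !inE eqxx orbT.
  have CW z : z \in C -> z \in i.1 by move=> zC; rewrite inE zC orbT.
  have c_a z : z \in C -> z != a by move=> zC; apply: contraTneq zC => ->.
  have cE x y : x \in M -> y \in M -> adj x y -> x \in i.1 -> y \in i.1 ->
      (x, y) != (a, u) -> (x, y) != (u, a) -> c x = c y.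
    move=> xM yM xy xW yW xyau xyua; apply/eqP; rewrite c_i //.
    by rewrite inE xyau.
  have c_C z : z \in C -> c z = c b.
    move=> zC; suff [] : z \in C /\ c z = c b by [].
    have : connect r b z by rewrite inE in zC.
    apply: (connect_ind (P := fun z => z \in C /\ c z = c b)) => // x y [xC <-].
    move=> /and5P[xM yM ax ay xy]; have yC := C_ext x y xC yM ay xy; split=> //.
    have xW := CW x xC; have yW := CW y yC.
    by apply/esym/cE; rewrite ?xpair_eqE ?(negPf (c_a _ xC)) ?(negPf (c_a _ yC)) ?andbF.
  (* Yet the values agree along the path a, v, zv, through C, zu, u. *)
  have : c a != c u by rewrite c_i // inE eqxx.
  move=> /eqP[]; transitivity (c v).
    by apply: cE => //; rewrite xpair_eqE ?eqxx ?(negPf vu) // eq_sym (negPf ua).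
  have c_zv : c zv = c v.
    have zvW := CW zv zvC.
    apply: cE; rewrite ?xpair_eqE ?(negPf vu) ?(negPf va) ?andbF //.
    by case: (CP zv zvC).
  have c_zu : c zu = c u.
    have zuW := CW zu zuC.
    apply: cE; rewrite ?xpair_eqE ?(negPf ua) ?(negPf (c_a _ zuC)) ?andbF //.
    by case: (CP zu zuC).
  by rewrite -c_zv -c_zu !c_C.
apply: (completable_amalgam M_st (T := T) (M1 := M1) (M2 := M2)) => //.
- by move=> x; rewrite !inE => /orP[bx|//]; rewrite bx.
- by apply: X_conf => //; exact: T_up.
- move=> e eX; have [/existsP[z /andP[ze zC]]|no_z] := boolP [exists z in e, z \in C].
    left; apply/fintype.subsetP => x /setIP[xe xM]; apply/setUP.
    have [xC|xC] := boolP (x \in C); [by left | right].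
    by apply: TI zC _ => //; apply/adjP; exists e.
  right; apply/fintype.subsetP => x /setIP[xe xM]; apply/setDP; split=> //.
  by apply: contraNN no_z => xC; apply/existsP; exists x; rewrite xe.
- by apply: IH => //; apply: flat_sub M_flat.
- by apply: IH => //; apply: flat_sub M_flat.
Qed.

End Phases.

(** * Making all small substructures completable *)

Section Sparse.
Variables (L : language) (G : permgroup L) (A B0 : structure L) (coh : Prop).
Hypothesis L_unary : unary_functions L.
Variable K : class L.
Hypotheses (K_hereditary : hereditary G K) (K_amalg : strong_amalgamation_property G K)
  (KA : K A).
Local Notation system := (system G A B0 coh).
Implicit Types X Y : system.

Definition nonadjacent X (S : {set pts X}) : {set pts X * pts X} :=
  [set p in finset.setX S S | ~~ adj p.1 p.2].

(** By [flat_completable], some nonadjacent pair of S has an adjacent image.  The other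
nonadjacent pairs already account for all nonadjacent pairs of the image, since
adjacency is preserved by p. *)
Lemma nonadjacent_covering X Y (p : smap G (str Y) (str X)) (S : {set pts Y}) :
  covering 1 p -> covered X -> conformal X -> stable S -> ~ completable K S ->
  #|nonadjacent (X := X) (p @: S)%SET| < #|nonadjacent S|.
Proof.
move=> p_cov X_cov X_conf S_st S_bad.
have [u [v [uS vS puv uv]]] : exists u v,
    [/\ u \in S, v \in S, adj (X := X) (p u) (p v) & ~~ adj u v].
  apply: contrapT => no_uv; apply: S_bad; apply: (completable_covering p_cov).
  apply: (flat_completable L_unary K_hereditary K_amalg KA X_cov X_conf).
    exact: covering_stable p_cov _ S_st.
  move=> i; apply: (covering_twist p_cov) => u v uS vS puv.
  by apply: contrapT => /negP uv; apply: no_uv; exists u, v.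
pose pp (w : pts Y * pts Y) : pts X * pts X := (p w.1, p w.2).
pose lifts := [set w in nonadjacent S | ~~ adj (X := X) (p w.1) (p w.2)].
have image_lifts : nonadjacent (X := X) (p @: S)%SET \subset (pp @: lifts)%SET.
  apply/fintype.subsetP => -[x y]; rewrite !inE /=.
  move=> /andP[/andP[/imsetP[x' x'S ->] /imsetP[y' y'S ->]] xy].
  apply/imsetP; exists (x', y') => //; rewrite !inE /= x'S y'S xy andbT /=.
  by apply: contraNN xy; apply: (covering_adj p_cov).
apply: (leq_ltn_trans (subset_leq_card image_lifts)).
apply: (leq_ltn_trans (leq_imset_card _ _)).
apply: proper_card; apply/fintype.properP; split.
  by apply/fintype.subsetP => w; rewrite inE => /andP[].
by exists (u, v); rewrite !inE /= uS vS uv ?puv.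
Qed.

Definition sparse k X := forall S : {set pts X}, stable S -> ~ completable K S ->
  k <= #|nonadjacent S|.

Lemma sparse_exists k X : covered X -> conformal X ->
  exists Y, [/\ covered Y, conformal Y & sparse k Y].
Proof.
move=> X_cov X_conf; elim: k => [|k [Y [Y_cov Y_conf Y_sp]]]; first by exists X.
have [Z [p p_cov]] := covering_exists Y 1 L_unary; exists Z; split.
- exact: covering_covered p_cov.
- exact: covering_conformal p_cov Y_conf.
- move=> S S_st S_bad.
  apply: leq_ltn_trans (nonadjacent_covering p_cov Y_cov Y_conf S_st S_bad).
  apply: Y_sp; first exact: covering_stable p_cov _ S_st.
  by move=> /(completable_covering p_cov).
Qed.

Lemma sparse_completable n X (S : {set pts X}) : sparse (n * n).+1 X -> stable S -> #|S| <= n ->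
  completable K S.
Proof.
move=> X_sp S_st S_le; apply: contrapT => /(X_sp S S_st); apply/negP.
rewrite -leqNgt; apply: leq_trans (leq_mul S_le S_le); rewrite -cardsX.
by apply/subset_leq_card/fintype.subsetP => w; rewrite inE => /andP[].
Qed.

End Sparse.

Section Irreducible.
Variables (L : language) (G : permgroup L) (A B0 : structure L) (coh : Prop).
Hypothesis L_unary : unary_functions L.
Variable X : system G A B0 coh.
Hypotheses (X_cov : covered X) (X_conf : conformal X).

Lemma embedding_range (C D : structure L) (f : smap G C D) :
  embedding f -> substructure G (range f).
Proof.
move=> [_ _ fF]; apply/substructureP => n F t tf.
have tf' k : exists c, f c = tnth t k by have [c _ ck] := tf k; exists c.
have [u uP] := choice tf'.
have -> : t = map_tuple f [tuple u k | k < n].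
  by apply: eq_from_tnth => k; rewrite tnth_map tnth_mktuple uP.
rewrite -(lfunKV (mlang f) F) -fF => _ [c _ <-].
by exists c.
Qed.

(** If g c and g d are not adjacent, then C is the free amalgam of the two sets of
vertices whose closure avoids c, respectively d: no edge contains both g c and
g d, so no closure of a single vertex and no tuple of a relation reaches both. *)
Lemma irreducible_adj (C : structure L) (g : smap G C (str X)) :
  irreducible G C -> embedding g -> forall c d, adj (X := X) (g c) (g d).
Proof.
move=> C_irr g_emb c d; apply: contrapT => cd; apply: C_irr.
have [g_inj gR gF] := g_emb.
(* The closure of g w is formed in X, where it corresponds to the closure of w in C. *)
pose avoid (z : C) : set C := fun w => ~~ connect (@arrow _ _ _ _ _ X) (g w) (g z).
have avoid_sub z : substructure G (avoid z).
  apply/substructureP; apply: (unary_fun_ind L_unary) => F w /(_ ord0) wz y Fy.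
  apply: contra wz; apply: connect_trans; apply/connect1/asboolP.
  exists (lfun (mlang g) F); rewrite -map_tuple1.
  have : (g @` fint F [tuple w])%classic (g y) by exists y.
  by rewrite gF.
have avoid_or w : avoid c w \/ avoid d w.
  apply: contrapT => /not_orP[/negP/negPn wc /negP/negPn wd]; apply: cd.
  have [e eX we] := X_cov.1 (g w); apply/adjP; exists e => //.
  by split; apply: (stable_connect (edge_stable eX) we).
pose S0 := (avoid c `&` avoid d)%classic.
have S01 : (S0 `<=` avoid c)%classic by move=> w [].
have S02 : (S0 `<=` avoid d)%classic by move=> w [].
have avoidN z : avoid z <> [set: C]%classic.
  move=> zT; have : [set: C]%classic z by []; rewrite -zT.
  by rewrite /avoid connect0.
exists S0, (avoid c), (avoid d), S01, S02; split=> //.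
  split=> //; apply/substructureP => n F t tS y Fy; split.
    by have /substructureP H := avoid_sub c; apply: H Fy => k; have [] := tS k.
  by have /substructureP H := avoid_sub d; apply: H Fy => k; have [] := tS k.
have incl_range (S T : set C) (ST : (S `<=` T)%classic) (w : induced T) :
    (~` range (inclusion_sub G ST))%classic w -> ~ S (val w).
  move=> wS Sw; apply: wS; exists (SigSub (mem_set Sw)) => //.
  exact: val_inj.
split.
- split; first by split; [exact: avoid_sub | exact: avoid_sub | exact: smap_eq].
  apply/seteqP; split=> [w [[u _ uw] [v _ vw]]|_ [w _ <-]].
    have Sw : S0 w.
      by split; [rewrite -uw; apply: (set_valP u) | rewrite -vw; apply: (set_valP v)].
    by exists (SigSub (mem_set Sw)).
  have [w1 w2] := set_valP w.
  by split; [exists (SigSub (mem_set w1)) | exists (SigSub (mem_set w2))].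
- apply/seteqP; split=> // w _; have [wc|wd] := avoid_or w; [left|right].
    by exists (SigSub (mem_set wc)).
  by exists (SigSub (mem_set wd)).
- have outside n (t : n.-tuple C) :
      meets t (inclusion G (avoid c) @` (~` range (inclusion_sub G S01)))%classic ->
      meets t (inclusion G (avoid d) @` (~` range (inclusion_sub G S02)))%classic ->
      exists k l, [/\ avoid c (tnth t k), ~ avoid d (tnth t k),
                      avoid d (tnth t l) & ~ avoid c (tnth t l)].
    move=> [k [u u0 uk]] [l [v v0 vl]]; exists k, l; rewrite -uk -vl.
    have uc := set_valP u; have vd := set_valP v.
    split=> //= H; [apply: (incl_range _ _ _ u u0) | apply: (incl_range _ _ _ v v0)]; by split.
  move=> n t /outside H /H[k [l [kc kd ld lc]]]; split=> [R Rt|].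
    apply: cd; have [e eX te] := X_cov.2 n _ _ ((gR n R t).1 Rt).
    have ge m : g (tnth t m) \in e by have := te m; rewrite tnth_map.
    apply/adjP; exists e => //; split.
      apply: (stable_connect (edge_stable eX) (ge l)); exact/negPn/negP.
    apply: (stable_connect (edge_stable eX) (ge k)); exact/negPn/negP.
  move=> F; have n1 := L_unary F; subst n.
  by case: lc; rewrite (ord1 l) -(ord1 k).
Qed.

Lemma irreducible_edge (C : structure L) (g : smap G C (str X)) :
  irreducible G C -> embedding g ->
  exists2 e, e \in edges X & forall c, g c \in e.
Proof.
move=> C_irr g_emb; pose S : {set pts X} := [set x | `[< range g x >]].
have SE : [set` S]%classic = range g.
  by apply/seteqP; split=> x; rewrite /= inE => /asboolP.
have S_st : stable S.
  by apply/(stableP L_unary); rewrite SE; apply: embedding_range.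
have S_cl : clique S.
  have Sg x : x \in S -> exists c, g c = x.
    by rewrite inE => /asboolP[c _ <-]; exists c.
  move=> x y /Sg[c <-] /Sg[d <-].
  exact: (irreducible_adj C_irr g_emb).
have [e eX /fintype.subsetP Se] := X_conf S_st S_cl; exists e => // c.
by apply: Se; rewrite inE; apply/asboolP; exists c.
Qed.

Lemma irreducible_embedding (C D : structure L) (g : smap G C (str X)) (f : smap G (str X) D)
    (S : {set pts X}) :
  irreducible G C -> embedding g -> (forall c, g c \in S) ->
  (forall e, e \in edges X -> embeds_on f [set` e :&: S]%classic) ->
  embedding (mcomp f g).
Proof.
move=> C_irr g_emb gS f_emb; have [e eX ge] := irreducible_edge C_irr g_emb.
apply/embedding_setT.
have H := @embeds_on_comp _ G C (str X) D [set: C]%classic [set` e :&: S]%classic f g.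
apply: H; last exact: f_emb.
  by move=> c _; apply/setIP.
exact/embedding_setT.
Qed.

End Irreducible.

(** * From an EPPA-witness to a system and from a system to a completion *)

(** The type itself is made a finite type, instead of a copy of it, so that no
structure or automorphism has to be transported. *)
Lemma finite_finType (T : Type) : finite_set [set: T]%classic ->
  exists F : finType, Finite.sort F = T.
Proof.
move=> /(@finite_seqP {classic T})[s sE].
have s_all : undup s =i predT.
  by move=> x; rewrite mem_undup; have : [set: T]%classic x by []; rewrite sE.
have fK : pcancel (fun x : {classic T} => index x (undup s)) (onth (undup s)).
  by move=> x; rewrite onthE (nth_map x) ?nth_index ?index_mem ?s_all.
pose C : countType := HB.pack {classic T} (PCanIsCountable fK).
have s_fin : Finite.axiom (undup s : seq C).
  by apply: Finite.uniq_enumP => //; apply: undup_uniq.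
pose F : finType := HB.pack {classic T} C (isFinite.Build C s_fin).
by exists F.
Qed.

Lemma finset_card_le (T : finType) (S : {set T}) n :
  ([set` S] #<= `I_n)%card%classic -> #|S| <= n.
Proof.
move=> /pcard_leP[f].
have [g g_inj g_lt] : exists2 g : T -> nat, {in S &, injective g} &
    forall x, x \in S -> g x < n.
  exists f => [x y xS yS|x xS]; first by apply: (@inj _ _ _ f); rewrite inE.
  exact: (@funS _ _ _ _ f).
rewrite cardE -(size_map g) -(size_iota 0 n).
apply: uniq_leq_size => [|_ /mapP[x xS ->]].
  by rewrite map_inj_in_uniq ?enum_uniq // => x y; rewrite !mem_enum; apply: g_inj.
by rewrite mem_iota /= add0n g_lt // -mem_enum.
Qed.

Lemma finite_structure_ind L (P : structure L -> Prop) :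
  (forall V R F, P (@finite_type_structure L V R F)) ->
  forall B, finite_structure B -> P B.
Proof.
move=> PV [T c R F] B_fin.
have [V VT] : exists V : finType, Finite.sort V = T by apply: finite_finType.
subst T.
by rewrite (Prop_irrelevance c (countableP [set: V]%classic)); apply: PV.
Qed.

Section Automorphisms.
Variables (L : language) (G : permgroup L).
Implicit Types A B : structure L.

Definition idmap_of A : smap G A A := SMap (pg1 G) id.

Lemma map_tuple_id (T : Type) n (t : n.-tuple T) : map_tuple id t = t.
Proof. by apply: val_inj; rewrite /= map_id. Qed.

Lemma idmap_auto A : automorphism (idmap_of A).
Proof.
split; last by exists id.
by split=> // [n R t|n F t]; rewrite map_tuple_id // image_id.
Qed.

Lemma automorphism_comp A (g h : smap G A A) :
  automorphism g -> automorphism h -> automorphism (mcomp g h).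
Proof.
by move=> [g_emb g_bij] [h_emb h_bij]; split; [exact: embedding_comp | exact: bij_comp].
Qed.

(** The common form of the two notions of EPPA-witness: coherence is demanded only
if [coh] holds. *)
Definition extends_partial (coh : Prop) A B (psi : smap G A B) :=
  embedding psi /\
  exists ext : forall S T : set (induced (range psi)),
      smap G (induced S) (induced T) -> smap G B B,
    (forall S T (f : smap G (induced S) (induced T)), partial_automorphism f ->
       automorphism (ext S T f) /\ extends f (ext S T f)) /\
    (coh -> forall S T U (f : smap G (induced S) (induced T))
         (g : smap G (induced T) (induced U)),
       partial_automorphism f -> partial_automorphism g ->
       ext S U (mcomp g f) = mcomp (ext T U g) (ext S T f)).

(** The edges are the images of A under all automorphisms of B. *)
Lemma orbit_system coh A B (psi : smap G A B) :
  finite_structure B -> extends_partial coh psi ->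
  inhabited (system G (induced (range psi)) B coh).
Proof.
move=> B_fin; move: B B_fin psi.
apply: finite_structure_ind => V R F psi [psi_emb [ext [extP ext_coh]]].
pose B := finite_type_structure R F.
pose D : set B := range psi.
have D_sub : substructure G D by apply: embedding_range.
pose edges : {set {set V}} := [set e : {set V} | `[< exists2 g : smap G B B,
  automorphism g & [set` e]%classic = range (mcomp g (inclusion G D)) >]].
have edgesP e : e \in edges -> exists2 g : smap G B B,
    automorphism g & [set` e]%classic = range (mcomp g (inclusion G D)).
  by rewrite inE => /asboolP.
have chart e : e \in edges ->
    exists2 phi : smap G (induced D) B, embedding phi & [set` e]%classic = range phi.
  move=> /edgesP[g [g_emb _] gE]; exists (mcomp g (inclusion G D)) => //.
  exact: embedding_comp.
have base_edge : exists2 e, e \in edges & [set` e]%classic = range (inclusion G D).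
  pose e0 : {set V} := [set x : V | `[< range (inclusion G D) x >]].
  have e0E : [set` e0]%classic = range (inclusion G D).
    by apply/seteqP; split=> x; rewrite /= inE => /asboolP.
  exists e0 => //; rewrite inE; apply/asboolP; exists (idmap_of B) => //.
  exact: idmap_auto.
have proj_edge e : e \in edges -> embeds_on (idmap_of B) [set` e]%classic.
  move=> _; have [/embedding_setT id_emb _] := idmap_auto B.
  exact: embeds_on_sub id_emb.
have proj_hom : homomorphism (idmap_of B).
  by have [id_emb _] := idmap_auto B; apply: embedding_homomorphism.
have ext_edges S T (f : smap G (induced S) (induced T)) e :
    partial_automorphism f -> e \in edges -> (ext S T f @: e)%SET \in edges.
  move=> f_auto /edgesP[g g_auto eE]; have [h_auto _] := extP S T f f_auto.
  rewrite inE; apply/asboolP; exists (mcomp (ext S T f) g).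
    exact: automorphism_comp.
  transitivity (ext S T f @` [set` e])%classic.
    apply/seteqP; split=> [x /imsetP[y ye ->]|_ [y ye <-]]; first by exists y.
    exact: imset_f.
  by rewrite eE image_comp.
split.
exact: (@System L G (induced D) B coh V R F edges chart (idmap_of B) proj_hom
  proj_edge (inclusion G D) erefl D_sub base_edge ext
  (fun S T f f_auto => (extP S T f f_auto).1) ext_edges
  (fun S T f f_auto => (extP S T f f_auto).2.1)
  (fun S T f f_auto => (extP S T f f_auto).2.2) ext_coh).
Qed.

End Automorphisms.

Section Pull.
Variables (L : language) (G : permgroup L) (A1 A2 : structure L).
Variables (iota : smap G A1 A2) (iota' : A2 -> A1).
Hypotheses (iota_emb : embedding iota) (iotaK : cancel iota iota') (iotaK' : cancel iota' iota).
Implicit Types S T U : set A2.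

Definition pull_in S (v : induced (iota @^-1` S)%classic) : induced S :=
  SigSub (mem_set (set_valP v : S (iota (val v)))).

Lemma pull_out_subproof S (w : induced S) : (iota @^-1` S)%classic (iota' (val w)).
Proof. by rewrite /= iotaK'; apply: set_valP. Qed.

Definition pull_out S (w : induced S) : induced (iota @^-1` S)%classic :=
  SigSub (mem_set (pull_out_subproof w)).

Lemma pull_inK S : cancel (@pull_in S) (@pull_out S).
Proof. by move=> v; apply: val_inj; rewrite /= iotaK. Qed.

Lemma pull_outK S : cancel (@pull_out S) (@pull_in S).
Proof. by move=> w; apply: val_inj; rewrite /= iotaK'. Qed.

(** Partial automorphisms of a copy of A1 as partial automorphisms of A1. *)
Definition conjugate S T (p : smap G (induced S) (induced T)) :
    smap G (induced (iota @^-1` S)%classic) (induced (iota @^-1` T)%classic) :=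
  SMap (pgM (pgV (mlangP iota)) (pgM (mlangP p) (mlangP iota)))
    (fun v => pull_out (p (pull_in v))).

Lemma conjugate_comp S T U (p : smap G (induced S) (induced T))
    (r : smap G (induced T) (induced U)) :
  conjugate (mcomp r p) = mcomp (conjugate r) (conjugate p).
Proof.
apply: smap_eq => [|v] /=; last by rewrite pull_outK.
rewrite -!lcompA; congr (lcomp _ (lcomp _ _)).
by rewrite lcompA lcompgV lcomp1.
Qed.

Lemma preimage_sub S : substructure G S -> substructure G (iota @^-1` S)%classic.
Proof.
move=> /substructureP S_sub; apply/substructureP => n F t tS y Fy.
have [_ _ iF] := iota_emb.
apply: (S_sub n (lfun (mlang iota) F) (map_tuple iota t)).
  by move=> k; rewrite tnth_map; apply: tS.
by rewrite -iF; exists y.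
Qed.

Lemma conjugate_partial S T (p : smap G (induced S) (induced T)) :
  partial_automorphism p -> partial_automorphism (conjugate p).
Proof.
move=> [S_sub T_sub [p_emb [p' pK pK']]].
have S'_sub := preimage_sub S_sub; have T'_sub := preimage_sub T_sub.
split=> //; split; last first.
  exists (fun v => pull_out (p' (pull_in v))) => v /=.
    by rewrite pull_outK pK pull_inK.
  by rewrite pull_outK pK' pull_inK.
pose j : smap G (induced (iota @^-1` S)%classic) (induced S) :=
  SMap (mlangP iota) (@pull_in S).
have j_emb : embedding j.
  apply: (embedding_mcompr (g := inclusion G S)) => //.
  have -> : mcomp (inclusion G S) j = mcomp iota (inclusion G (iota @^-1` S)%classic).
    by apply: smap_eq => //=; rewrite lcomp1 lcompg1.
  exact: embedding_comp.
apply: (embedding_mcompr (g := mcomp iota (inclusion G (iota @^-1` T)%classic))).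
  exact: embedding_comp.
have -> : mcomp (mcomp iota (inclusion G (iota @^-1` T)%classic)) (conjugate p)
    = mcomp (inclusion G T) (mcomp p j).
  apply: smap_eq => [|v] /=; last by rewrite iotaK'.
  by rewrite lcompg1 lcomp1 lcompA lcompgV lcomp1.
by apply: embedding_comp => //; apply: embedding_comp.
Qed.

End Pull.

Section Final.
Variables (L : language) (G : permgroup L) (E K : class L).
Hypotheses (L_unary : unary_functions L)
    (K_irr : subclass K (irreducible G))
    (K_hereditary : hereditary G K)
    (K_lf : locally_finite_automorphism_preserving G K E)
    (K_amalg : strong_amalgamation_property G K).

Definition corestriction (A B : structure L) (f : smap G A B) : smap G A (induced (range f)) :=
  @SMap _ _ A (induced (range f)) _ (mlangP f)
    (fun a => SigSub (mem_set (ex_intro2 _ _ a I erefl : range f (f a)))).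

Lemma corestriction_embedding (A B : structure L) (f : smap G A B) :
  embedding f -> embedding (corestriction f).
Proof.
move=> f_emb; apply: (embedding_mcompr (g := inclusion G (range f))).
  exact: embedding_range.
have -> // : mcomp (inclusion G (range f)) (corestriction f) = f.
by apply: smap_eq => //=; apply: lcomp1.
Qed.

Lemma corestriction_inverse (A B : structure L) (f : smap G A B) :
  embedding f -> exists h : smap G (induced (range f)) A, embedding h.
Proof.
move=> f_emb.
have inv (v : induced (range f)) : exists a, f a = val v.
  by have [a _ av] := set_valP v; exists a.
have [h hP] := choice inv.
exists (SMap (pgV (mlangP f)) h); apply: (embedding_mcompr f_emb).
have -> : mcomp f (SMap (pgV (mlangP f)) h) = inclusion G (range f).
  by apply: smap_eq => //=; rewrite lcompgV.
exact: embedding_range.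
Qed.

Lemma K_range (A B : structure L) (f : smap G A B) :
  K A -> embedding f -> K (induced (range f)).
Proof. by move=> KA f_emb; apply: K_hereditary KA _; apply: corestriction_inverse. Qed.

(** Local finiteness applies with the bound n for A and B0 to a conformal system
in which every substructure with at most n vertices is completable. *)
Lemma completion_exists coh (A B0 : structure L) (X : system G A B0 coh) :
  K A -> E B0 -> exists (Y : system G A B0 coh) B',
    K B' /\ automorphism_preserving_completion G (str Y) B'.
Proof.
move=> KA EB0; have [n complete_n] := (let: And4 _ _ _ H := K_lf in H) A B0 KA EB0.
have [X1 [X1_cov X1_conf]] := conformal_exists L_unary X.
have [Y [Y_cov Y_conf Y_sp]] :=
  sparse_exists L_unary K_hereditary K_amalg KA (n * n).+1 X1_cov X1_conf.
have edge_of := irreducible_edge L_unary Y_cov Y_conf.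
exists Y; apply: complete_n.
- exact: finite_finset.
- move=> S S_sub S_irr; have [e eY Se] := edge_of _ (inclusion G S) S_irr S_sub.
  have [f f_emb] := edge_retraction Y_cov eY.
  exists (mcomp f (inclusion G S)); apply/(embedding_inclusion f S_sub).
  apply: embeds_on_sub f_emb => x Sx.
  exact: (Se (SigSub (mem_set Sx))).
- exists (proj Y); split=> [|S S_sub S_irr]; first exact: proj_hom.
  have [e eY Se] := edge_of _ (inclusion G S) S_irr S_sub.
  apply/(embedding_inclusion _ S_sub); apply: embeds_on_sub (proj_edge eY) => x Sx.
  exact: (Se (SigSub (mem_set Sx))).
- move=> S S_sub S_le.
  pose Sf : {set pts Y} := [set x | `[< S x >]].
  have SfE : [set` Sf]%classic = S.
    by apply/seteqP; split=> x; rewrite /= inE => /asboolP.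
  have Sf_st : stable Sf by apply/(stableP L_unary); rewrite SfE.
  have Sf_le : #|Sf| <= n.
    by apply: finset_card_le; rewrite SfE.
  have [C KC [f f_emb]] := sparse_completable Y_sp Sf_st Sf_le.
  exists C; split=> //; split; first exact: K_irr.
  have memS (v : induced S) : val v \in Sf by rewrite inE; apply/asboolP/set_valP.
  exists (mcomp f (inclusion G S)); split; last first.
    move=> S' S'_sub S'_irr.
    have -> : mcomp (mcomp f (inclusion G S)) (inclusion G S')
        = mcomp f (mcomp (inclusion G S) (inclusion G S')).
      by apply: smap_eq => //=; rewrite lcompA.
    apply: (irreducible_embedding L_unary Y_cov Y_conf S'_irr _ _ f_emb).
      exact: embedding_comp.
    by move=> v; apply: memS.
  split=> [m R t Rt|].
    have [e eY te] := Y_cov.2 _ _ _ Rt.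
    have [_ fR _] := f_emb e eY; rewrite -map_tuple_comp.
    rewrite /= lcompg1; apply/(fR m R); last exact: Rt.
    move=> k; rewrite tnth_map /=; apply/setIP; split; last exact: memS.
    by have := te k; rewrite tnth_map.
  apply: (unary_fun_ind L_unary) => F v.
  have [e eY ve] := Y_cov.1 (val v).
  have [_ _ fF] := f_emb e eY; rewrite -map_tuple_comp -image_comp /= lcompg1 map_tuple1.
  rewrite -fF; last first.
    by move=> k; rewrite (ord1 k) (tnth_nth (val v)); apply/setIP; split; [exact: ve | exact: memS].
  by apply: image_subset => x [w Fw <-].
Qed.

(** The copy of A in Y is irreducible, so it is embedded in the completion B'.  A
partial automorphism of its image is conjugated to one of A, extended to Y, and
then to B'. *)
Lemma transfer_extension coh (A B0 : structure L) (psi : smap G A B0)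
    (Y : system G (induced (range psi)) B0 coh) (B' : structure L) :
  K A -> embedding psi -> automorphism_preserving_completion G (str Y) B' ->
  exists psi' : smap G A B', extends_partial coh psi'.
Proof.
move=> KA psi_emb [_ [f [[_ f_emb] f_inj [ext' [ext'P ext'_comp]]]]].
pose A1 := induced (range psi); have KA1 : K A1 by apply: K_range.
pose psi1 : smap G A A1 := corestriction psi.
have psi1_emb : embedding psi1 by apply: corestriction_embedding.
have psi1_surj (v : A1) : exists a, psi1 a = v.
  by have [a _ av] := set_valP v; exists a; apply: val_inj.
have b_emb := base_embedding Y.
pose fb : smap G A1 B' := mcomp f (base Y).
have fb_emb : embedding fb.
  have r_sub := embedding_range b_emb.
  have r_irr : irreducible G (induced (range (base Y))) by apply/K_irr/K_range.
  have /(embedding_inclusion f r_sub) fr_emb := f_emb _ r_sub r_irr.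
  apply/embedding_setT.
  have H := @embeds_on_comp _ G A1 (str Y) B' [set: A1]%classic (range (base Y)) f (base Y).
  apply: H; [by move=> v _; exists v | exact/embedding_setT | exact: fr_emb].
pose psi' : smap G A B' := mcomp fb psi1.
have psi'_emb : embedding psi' by apply: embedding_comp.
exists psi'; split=> //.
pose A2 := induced (range psi').
have fb_range (v : A1) : range psi' (fb v).
  by have [a <-] := psi1_surj v; exists a.
pose iota : smap G A1 A2 :=
  @SMap _ G A1 A2 _ (mlangP fb) (fun v => SigSub (mem_set (fb_range v))).
have iota_emb : embedding iota.
  apply: (embedding_mcompr (g := inclusion G (range psi'))).
    exact: embedding_range.
  have -> // : mcomp (inclusion G (range psi')) iota = fb.
  by apply: smap_eq => //=; apply: lcomp1.
have inv (w : A2) : exists v, iota v = w.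
  by have [a _ aw] := set_valP w; exists (psi1 a); apply: val_inj.
have [iota' iotaK'] := choice inv.
have iotaK : cancel iota iota'.
  by move=> v; have [i_inj _ _] := iota_emb; apply: i_inj; rewrite iotaK'.
pose lift S T (p : smap G (induced S) (induced T)) := ext Y (conjugate iotaK' p).
have lift_auto S T (p : smap G (induced S) (induced T)) :
    partial_automorphism p -> automorphism (lift S T p).
  by move=> p_auto; apply/ext_auto/conjugate_partial.
exists (fun S T p => ext' (lift S T p)); split; last first.
  move=> c S T U p r p_auto r_auto.
  rewrite -ext'_comp; [|exact: lift_auto|exact: lift_auto].
  rewrite /lift conjugate_comp (ext_comp Y c) //; exact: conjugate_partial.
move=> S T p p_auto; have [e_auto e_f] := ext'P _ (lift_auto _ _ _ p_auto).
have c_auto := conjugate_partial iota_emb iotaK iotaK' p_auto.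
split=> //; split=> [|v].
  have l_e : lcomp (mlang (ext' (lift S T p))) (mlang f) = lcomp (mlang f) (mlang (lift S T p)).
    by have := congr1 (@mlang _ _ _ _) e_f.
  have l_lift : mlang (lift S T p) = lcomp (linv (mlang f)) (lcomp (mlang p) (mlang f)).
    by rewrite /lift (ext_lang Y c_auto) /= base_lang lcompg1.
  rewrite -[LHS]lcompg1 -(lcompgV (mlang f)) lcompA l_e l_lift.
  by rewrite !lcompA lcompgV lcomp1 -lcompA lcompgV lcompg1.
have e_fx x : ext' (lift S T p) (f x) = f (lift S T p x).
  by have := congr1 (fun m : smap G (str Y) B' => m x) e_f.
have valE (w : A2) : val w = fb (iota' w) by rewrite -{1}(iotaK' w).
have v_pre : S (iota (iota' (val v))) by rewrite iotaK'; apply: set_valP.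
pose v' : induced (iota @^-1` S)%classic := SigSub (mem_set v_pre).
have v'E : pull_in v' = v by apply: val_inj; apply: iotaK'.
rewrite !valE /= e_fx; congr (f _).
rewrite -[iota' (val v)]/(val v') /lift (ext_base Y c_auto) /=.
by rewrite v'E.
Qed.

End Final.

Theorem theorem1p6 (L : language) (G : permgroup L) (E K : class L)
    (L_unary : unary_functions L)
    (E_finite : subclass E (@finite_structure L))
    (E_EPPA : has_EPPA G E)
    (K_irr : subclass K (irreducible G))
    (K_hereditary : hereditary G K)
    (K_lf : locally_finite_automorphism_preserving G K E)
    (K_amalg : strong_amalgamation_property G K) :
  has_EPPA G K /\ (has_coherent_EPPA G E -> has_coherent_EPPA G K).
Proof.
have [_ KE _ _] := K_lf.
have transfer coh A B0 (psi : smap G A B0) : K A -> E B0 -> extends_partial coh psi ->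
    exists2 B', K B' & exists psi' : smap G A B', extends_partial coh psi'.
  move=> KA EB0 psi_ext; have psi_emb := psi_ext.1.
  have [X] := orbit_system (E_finite B0 EB0) psi_ext.
  have KA1 : K (induced (range psi)) by apply: (K_range K_hereditary).
  have [Y [B' [KB' B'_compl]]] :=
    completion_exists L_unary K_irr K_hereditary K_lf K_amalg X KA1 EB0.
  exists B' => //; exact: (transfer_extension K_irr K_hereditary KA psi_emb B'_compl).
have K_fin A : K A -> finite_structure A by move=> /KE/E_finite.
split=> [A KA|E_coh A KA].
  have [B0 [EB0 [_ _ [psi [psi_emb psi_ext]]]]] := E_EPPA A (KE A KA).
  have psi_ext' : extends_partial False psi.
    split=> //.
    have ext_ex (S T : set (induced (range psi))) (f : smap G (induced S) (induced T)) :
        exists t : smap G B0 B0, partial_automorphism f -> automorphism t /\ extends f t.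
      have [f_auto|nf] := pselect (partial_automorphism f).
        by have [t tP] := psi_ext S T f f_auto; exists t.
      by exists (idmap_of G B0) => /nf.
    exists (fun S T f => projT1 (cid (ext_ex S T f))); split=> // S T f.
    exact: (projT2 (cid (ext_ex S T f))).
  have [B' KB' [psi' [psi'_emb [ext [extP _]]]]] := transfer _ _ _ psi KA EB0 psi_ext'.
  exists B'; split=> //; split; [exact: K_fin | exact: K_fin |].
  by exists psi'; split=> // S T f f_auto; exists (ext S T f); apply: extP.
have [B0 [EB0 [_ _ [psi [psi_emb [ext [extP extC]]]]]]] := E_coh A (KE A KA).
have psi_ext : extends_partial True psi by split=> //; exists ext.
have [B' KB' [psi' [psi'_emb [ext' [ext'P ext'C]]]]] := transfer _ _ _ psi KA EB0 psi_ext.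
exists B'; split=> //; split; [exact: K_fin | exact: K_fin |].
by exists psi'; split=> //; exists ext'; split=> //; apply: ext'C.
Qed.
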